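(* Let $d=2$. There exist two positive constants $C_1$ and $C_2$ such that for every integer $n\ge 1$, every measurable set $B\subset\mathbb{T}^2$ of normalized measure $|B|\le (C_2\,2^n n^{1/2})^{-1}$ and every $f\in\mathcal{T}(\Delta Q_n)$, $$\|f\|_\infty\le C_1\,n\sup_{\mathbf{u}\in\mathbb{T}^2\setminus B}|f(\mathbf{u})|.$$
   Context: $\mathbb{T}^2$ is the two-dimensional torus $[0,2\pi)^2$ (functions are $2\pi$-periodic in each variable), and $|B|$ is the normalized Lebesgue measure, so $|\mathbb{T}^2|=1$. For $\mathbf{s}=(s_1,s_2)$ with nonnegative integer coordinates put $\|\mathbf{s}\|_1=s_1+s_2$ and $$\rho(\mathbf{s}):=\{\mathbf{k}=(k_1,k_2)\in\mathbb{Z}^2:\ [2^{s_j-1}]\le|k_j|<2^{s_j},\ j=1,2\},$$ where $[a]$ is the integer part of $a$. Let $$Q_n:=\bigcup_{\|\mathbf{s}\|_1\le n}\rho(\mathbf{s}),\qquad \Delta Q_n:=Q_n\setminus Q_{n-1}=\bigcup_{\|\mathbf{s}\|_1=n}\rho(\mathbf{s}).$$ For $\Lambda\subset\mathbb{Z}^2$, $\mathcal{T}(\Lambda):=\{f\in L_1(\mathbb{T}^2):\ \hat f(\mathbf{k})=0 \text{ for } \mathbf{k}\in\mathbb{Z}^2\setminus\Lambda\}$; for finite $\Lambda$ this is the space of trigonometric polynomials with frequencies in $\Lambda$. $\|f\|_\infty$ is the supremum norm over $\mathbb{T}^2$. *)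

(* Defs.v *)
From HB Require Import structures.
From mathcomp Require Import all_boot all_order all_algebra complex.
From mathcomp Require Import all_classical all_reals all_analysis.

Set Implicit Arguments.
Unset Strict Implicit.
Unset Printing Implicit Defensive.

Import Order.TTheory GRing.Theory Num.Theory.
Import numFieldNormedType.Exports.

Local Open Scope classical_set_scope.
Local Open Scope ring_scope.
Local Open Scope complex_scope.

(* [2 ^ s %/ 2] is the integer part of 2^(s-1), including for s = 0. *)
Definition dyadic_range (s : nat) (k : int) : bool :=
  ((2 ^ s %/ 2 <= `|k|) && (`|k| < 2 ^ s))%N.

Definition rho (s : nat * nat) : set (int * int) :=
  [set k | dyadic_range s.1 k.1 /\ dyadic_range s.2 k.2].

Definition Q (n : nat) : set (int * int) :=
  \bigcup_(s in [set s : nat * nat | (s.1 + s.2 <= n)%N]) rho s.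

(* Meaningful for n >= 1 only, because of the truncated predecessor. *)
Definition DeltaQ (n : nat) : set (int * int) := Q n `\` Q n.-1.

Definition torus (R : realType) : set (R * R) :=
  `[0, 2 * pi[ `*` `[0, 2 * pi[.

Definition leb2 (R : realType) :
    {measure set (measurableTypeR R * measurableTypeR R) -> \bar R} :=
  (@lebesgue_measure R \x @lebesgue_measure R)%E.

(* Lebesgue (not only Borel) measurability: the Caratheodory measurable sets
   of the outer measure of [leb2]; on them this outer measure is the completed
   Lebesgue measure. *)
Definition leb2_measurable (R : realType) (B : set (R * R)) : Prop :=
  caratheodory_measurable (mu_ext (leb2 R)) B.

Definition nmeas (R : realType) (B : set (R * R)) : \bar R :=
  (((2 * pi) ^- 2)%:E * mu_ext (leb2 R) B)%E.

Definition periodic2 (R : realType) (f : R * R -> R[i]) : Prop :=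
  forall x y : R, f (x + 2 * pi, y) = f (x, y) /\ f (x, y + 2 * pi) = f (x, y).

Definition L1_torus (R : realType) (f : R * R -> R[i]) : Prop :=
  [/\ periodic2 f,
      (leb2 R).-integrable (@torus R) (EFin \o (fun u => complex.Re (f u))) &
      (leb2 R).-integrable (@torus R) (EFin \o (fun u => complex.Im (f u)))].

Definition torus_int (R : realType) (g : R * R -> R[i]) : R[i] :=
  ((2 * pi) ^- 2)%:C *
  (Rintegral (leb2 R) (@torus R) (fun u => complex.Re (g u)) +i*
   Rintegral (leb2 R) (@torus R) (fun u => complex.Im (g u))).

(* exp (- i (k, u)) *)
Definition expNi (R : realType) (k : int * int) (u : R * R) : R[i] :=
  let t := k.1%:~R * u.1 + k.2%:~R * u.2 in cos t -i* sin t.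

Definition fourier_coef (R : realType) (f : R * R -> R[i]) (k : int * int) :
    R[i] := torus_int (fun u => f u * expNi k u).

(* Elements of L_1 are represented by functions, not by classes modulo almost
   everywhere equality. *)
Definition T_space (R : realType) (Lambda : set (int * int))
    (f : R * R -> R[i]) : Prop :=
  L1_torus f /\ forall k, ~ Lambda k -> fourier_coef f k = 0.

Definition sup_norm_on (R : realType) (A : set (R * R)) (f : R * R -> R[i]) :
    \bar R := ereal_sup [set (Normc.normc (f u))%:E | u in A].

(* Main.v *)
(** Let F_N be the Fejer kernel and V_j = 2 F_(2^j) - F_(2^(j-1)), V_0 = 0.
    The kernel K = sum_(j <= n) (V_(j+1) - V_j) (x) V_(n-j+1) has all its
    Fourier coefficients equal to 1 on Q_n, so f = f * K.  It is dominated by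
    P = sum_(j <= n) H_j (x) H_(n-j), where H_j is a nonnegative combination of
    Fejer kernels with integral O(1) and H_j = O(2^j).  Hence the mean of P is
    O(n).  In the mean of P^3, the term of indices i, j, k is
    O(4^n 2^(-(max - min))), so that this mean is O(n 4^n).  With
    lam ~ 2^n n^(1/2), the bound P <= lam + P^3 / lam^2 makes the mean of 1_B P
    at most 1/2 as soon as |B| is a small multiple of 1 / lam, and
    |f(x)| <= mean(|f| P(x - .)) <= O(n) sup_(T^2 \ B) |f| + ||f||_oo / 2. *)

Require Import Defs.
From mathcomp Require Import all_boot all_order all_algebra complex.
From mathcomp Require Import all_classical all_reals all_analysis.
From mathcomp Require Import measurable_realfun ring lra.
Import Order.TTheory GRing.Theory Num.Theory.
Import numFieldNormedType.Exports.
Local Open Scope classical_set_scope.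
Local Open Scope ring_scope.
Local Open Scope complex_scope.

(** * Fejer and de la Vallee Poussin kernels *)

(** The third power is what produces n^(1/2). For an integer p >= 2 the same counting gives O(n
    2^(n(p-1))) for the mean of P^p, and P <= lam + P^p / lam^(p-1) then asks for lam ~ 2^n
    n^(1/(p-1)); p = 2 would only admit sets of measure about 1 / (2^n n). The identity f = f * K is
    not a computation with a finite sum, since f is known only through the vanishing of its
    coefficients. It comes from comparing f * K with the Fejer means of f, which tend to f: both
    reduce to the same finitely many frequency means, with weights that agree in the limit. The
    kernels are real and even in each variable, so the argument is run for a real function tested
    against products of cosines. The sign symmetry of Q_n transfers the hypothesis on f to its real
    and imaginary parts, at the cost of a factor 2. *)

Section FejerKernel.
Context {R : realType}.
Implicit Types (t : R) (N L k : nat).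

(** This is |sum_(m < N) e^(imt)|^2 / N in real form. Since the inverse of 0 is 0, [fejer 0]
    vanishes, and hence so does V_0. *)
Definition fejer N t : R := N%:R^-1 *
  ((\sum_(m < N) cos (m%:R * t)) ^+ 2 + (\sum_(m < N) sin (m%:R * t)) ^+ 2).

(** The weight of cos(kt) once the frequencies k and -k are merged. *)
Definition cosw k : R := if k == 0%N then 1 else 2.

(** The truncated subtraction makes this the positive part of 1 - k/N. *)
Definition fejer_coef N k : R := (N - k)%:R / N%:R.

(** Adding e^(iNt) to the geometric sum S changes |S|^2 by 1 + 2 Re(conj(S) e^(iNt)), which is the
    Dirichlet kernel of order N once the sum is read backwards. *)
Lemma dirichlet_sum_step N t :
  (\sum_(m < N.+1) cos (m%:R * t)) ^+ 2 + (\sum_(m < N.+1) sin (m%:R * t)) ^+ 2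
  = (\sum_(m < N) cos (m%:R * t)) ^+ 2 + (\sum_(m < N) sin (m%:R * t)) ^+ 2
    + \sum_(k < N.+1) cosw k * cos (k%:R * t).
Proof.
rewrite [X in X ^+ 2 + _]big_ord_recr [X in _ + X ^+ 2 = _]big_ord_recr /=.
set C := \sum_(m < N) _; set S := \sum_(m < N) _.
have -> : \sum_(k < N.+1) cosw k * cos (k%:R * t)
    = 1 + 2 * (C * cos (N%:R * t) + S * sin (N%:R * t)).
  rewrite big_ord_recl /= /cosw /= mul0r cos0 mulr1; congr (_ + _).
  rewrite -mulr_sumr; congr (_ * _).
  rewrite /C /S !mulr_suml -big_split /= (reindex_inj rev_ord_inj) /=.
  apply: eq_bigr => i _.
  rewrite /bump /= add1n subnSK // natrB; last exact: ltnW.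
  by rewrite mulrBl cosB mulrC [X in _ + X]mulrC.
have := cos2Dsin2 (N%:R * t).
set c := cos _; set s := sin _ => cs.
transitivity (C ^+ 2 + S ^+ 2 + ((c ^+ 2 + s ^+ 2) + 2 * (C * c + S * s))).
  by ring.
by rewrite cs.
Qed.

Lemma dirichlet_sum_expand N t :
  (\sum_(m < N) cos (m%:R * t)) ^+ 2 + (\sum_(m < N) sin (m%:R * t)) ^+ 2
  = \sum_(k < N) cosw k * (N - k)%:R * cos (k%:R * t).
Proof.
elim: N => [|N IH]; first by rewrite !big_ord0 expr0n addr0.
rewrite dirichlet_sum_step IH.
rewrite [in RHS]big_ord_recr /= [in LHS]big_ord_recr /= addrA -big_split /=.
congr (_ + _); last by rewrite subSnn mulr1.
by apply: eq_bigr => i _; rewrite subSn 1?ltnW // -natr1; ring.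
Qed.

Lemma dirichlet_kernel_closed N t :
  (1 - cos t) * (\sum_(k < N.+1) cosw k * cos (k%:R * t))
  = cos (N%:R * t) - cos (N.+1%:R * t).
Proof.
elim: N => [|N IH].
  by rewrite big_ord_recl big_ord0 /cosw /= !mul0r cos0 addr0 !mulr1 mul1r.
rewrite big_ord_recr /= mulrDr IH /cosw /=.
have -> : N%:R * t = N.+1%:R * t - t by rewrite -natr1; ring.
have -> : N.+2%:R * t = N.+1%:R * t + t by rewrite -[N.+2%:R]natr1; ring.
by rewrite cosB cosD; ring.
Qed.

Lemma fejer_ge0 N t : 0 <= fejer N t.
Proof. by rewrite mulr_ge0 ?invr_ge0 // addr_ge0 ?sqr_ge0. Qed.

(** The length [L] is free so that kernels of different orders can be expanded over a common
    range. *)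
Lemma fejerE N L t : (N <= L)%N ->
  fejer N t = \sum_(k < L) cosw k * fejer_coef N k * cos (k%:R * t).
Proof.
move=> NL; rewrite /fejer dirichlet_sum_expand mulr_sumr.
rewrite -(subnK NL) addnC big_split_ord /= [X in _ = _ + X]big1 ?addr0.
  by apply: eq_bigr => i _; rewrite /fejer_coef; ring.
move=> i _; rewrite /fejer_coef /=.
by have /eqP -> : (N - (N + i) == 0)%N; rewrite ?subn_eq0 ?leq_addr // mul0r mulr0 mul0r.
Qed.

Lemma fejer_le N t : fejer N t <= 2 * N%:R.
Proof.
case: N => [|N]; first by rewrite /fejer invr0 mul0r mulr0.
rewrite /fejer ler_pdivrMl ?ltr0n //.
have sqle (u : nat -> R) : (forall m, `|u m| <= 1) ->
    (\sum_(m < N.+1) u m) ^+ 2 <= N.+1%:R ^+ 2.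
  move=> u1; rewrite -real_normK ?num_real // ler_pXn2r ?nnegrE //.
  apply: (le_trans (ler_norm_sum _ _ _)).
  rewrite -[N.+1 in leRHS]card_ord -sumr_const; exact: ler_sum.
have := sqle (fun m => cos (m%:R * t)) (fun m => cos_max _).
have := sqle (fun m => sin (m%:R * t)) (fun m => sin_max _).
lra.
Qed.

(** Summing the Dirichlet kernels gives (1 - cos t) F_N(t) = (1 - cos(Nt)) / N. This expresses the
    concentration of F_N at 0 without splitting any integral. *)
Lemma fejer_decay N t : (0 < N)%N -> (1 - cos t) * fejer N t <= 2 / N%:R.
Proof.
move=> N0; rewrite /fejer mulrCA mulrC ler_wpM2r ?invr_ge0 //.
have -> : (1 - cos t) * ((\sum_(m < N) cos (m%:R * t)) ^+ 2
    + (\sum_(m < N) sin (m%:R * t)) ^+ 2) = 1 - cos (N%:R * t).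
  elim: N {N0} => [|N IH]; first by rewrite !big_ord0 expr0n addr0 mulr0 mul0r cos0 subrr.
  by rewrite dirichlet_sum_step mulrDr IH dirichlet_kernel_closed; ring.
have := cos_geN1 (N%:R * t); lra.
Qed.

Lemma fejer_coef1B N k : (0 < N)%N -> (k <= N)%N ->
  fejer_coef N k = 1 - k%:R / N%:R.
Proof.
move=> N0 kN; rewrite /fejer_coef natrB // mulrBl divff // pnatr_eq0 -lt0n //.
Qed.

Lemma fejer_coef_eq0 N k : (N <= k)%N -> fejer_coef N k = 0.
Proof. by rewrite /fejer_coef -subn_eq0 => /eqP ->; rewrite mul0r. Qed.

(* The integer part of 2^(j-1), also for j = 0. *)
Definition half_pow (j : nat) : nat := if j is i.+1 then (2 ^ i)%N else 0%N.

(** * The hyperbolic cross kernel and its positive majorant *)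

Definition vallee j t : R := 2 * fejer (2 * half_pow j) t - fejer (half_pow j) t.

Definition vallee_coef j k : R :=
  2 * fejer_coef (2 * half_pow j) k - fejer_coef (half_pow j) k.

(** Only the first variable is cut into differences, so there are n + 1 products rather than one for
    each pair of dyadic blocks; this keeps the mean of the majorant at O(n). *)
Definition hyp_kernel n t1 t2 : R := \sum_(j < n.+1)
  (vallee j.+1 t1 - vallee j t1) * vallee (n - j).+1 t2.

Definition hyp_coef n k l : R := \sum_(j < n.+1)
  (vallee_coef j.+1 k - vallee_coef j k) * vallee_coef (n - j).+1 l.

(** The kernel H_j: all signs in V_(j+1) - V_j are turned positive, so that it dominates both this
    difference and V_(j+1). *)
Definition block_majorant j t : R :=
  2 * fejer (2 * half_pow j.+1) t + fejer (half_pow j.+1) t +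
  (2 * fejer (2 * half_pow j) t + fejer (half_pow j) t).

Lemma valleeE j L t : (2 * half_pow j <= L)%N ->
  vallee j t = \sum_(k < L) cosw k * vallee_coef j k * cos (k%:R * t).
Proof.
move=> jL; rewrite /vallee (fejerE _ _ _ jL) (fejerE (half_pow j) L); last first.
  by apply: leq_trans jL; rewrite leq_pmull.
rewrite mulr_sumr -sumrB; apply: eq_bigr => k _; rewrite /vallee_coef; ring.
Qed.

Lemma vallee_coef0 k : vallee_coef 0 k = 0.
Proof. by rewrite /vallee_coef /= !fejer_coef_eq0 // mulr0 subrr. Qed.

(** The linear parts cancel: 2 (1 - k/(2p)) - (1 - k/p) = 1 with p = 2^j. *)
Lemma vallee_coef1 j k : (k <= 2 ^ j)%N -> vallee_coef j.+1 k = 1.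
Proof.
move=> kj; have p0 : (0 < 2 ^ j)%N by rewrite expn_gt0.
rewrite /vallee_coef /= !fejer_coef1B ?muln_gt0 //; last first.
  by apply: leq_trans kj _; rewrite leq_pmull.
have : (2 ^ j)%:R != 0 :> R by rewrite pnatr_eq0 -lt0n.
by rewrite natrM; move: (2 ^ j)%:R => p h; field.
Qed.

Lemma half_pow_double j L : (j <= L)%N -> (2 * half_pow j <= 2 ^ L)%N.
Proof.
by case: j => // j jL; rewrite /= -expnS leq_exp2l.
Qed.

Lemma hyp_kernelE n L t1 t2 : (2 ^ n.+1 <= L)%N ->
  hyp_kernel n t1 t2 = \sum_(k < L) \sum_(l < L)
    cosw k * cosw l * hyp_coef n k l * (cos (k%:R * t1) * cos (l%:R * t2)).
Proof.
move=> nL; rewrite /hyp_kernel.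
have E j t : (j <= n.+1)%N ->
    vallee j t = \sum_(k < L) cosw k * vallee_coef j k * cos (k%:R * t).
  by move=> jn; apply: valleeE; apply: leq_trans nL; exact: half_pow_double.
transitivity (\sum_(j < n.+1) \sum_(k < L) \sum_(l < L)
    (cosw k * (vallee_coef j.+1 k - vallee_coef j k) * cos (k%:R * t1)) *
    (cosw l * vallee_coef (n - j).+1 l * cos (l%:R * t2))).
  apply: eq_bigr => j _; have jn := ltn_ord j.
  rewrite (E _ _ jn) (E _ _ (ltnW jn)) (E (n - j).+1) ?ltnS ?leq_subr //.
  rewrite -sumrB mulr_suml; apply: eq_bigr => k _; rewrite mulr_sumr.
  by apply: eq_bigr => l _; ring.
rewrite exchange_big; apply: eq_bigr => k _ /=.
rewrite exchange_big; apply: eq_bigr => l _ /=.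
rewrite /hyp_coef mulr_sumr mulr_suml; apply: eq_bigr => j _; ring.
Qed.

Lemma hyp_coef1 n s1 s2 k l : (s1 + s2 <= n)%N ->
  (k <= 2 ^ s1)%N -> (l <= 2 ^ s2)%N -> hyp_coef n k l = 1.
Proof.
move=> sn ks ls.
have mono k' a b : (k' <= 2 ^ a)%N -> (a <= b)%N -> (k' <= 2 ^ b)%N.
  by move=> ka ab; apply: (leq_trans ka); rewrite leq_exp2l.
(* Whenever the difference in k does not vanish, the factor in l equals 1. *)
transitivity (\sum_(0 <= j < n.+1) (vallee_coef j.+1 k - vallee_coef j k)).
  rewrite big_mkord; apply: eq_bigr => -[j /= jn] _.
  case: (leqP j s1) => js.
    rewrite (@vallee_coef1 (n - j) l) ?mulr1 //; apply: (mono _ s2) => //.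
    by rewrite leq_subRL // (leq_trans _ sn) // leq_add2r.
  case: j jn js => // j jn js.
  have kj : (k <= 2 ^ j)%N by exact: (mono _ _ _ ks js).
  by rewrite (vallee_coef1 j.+1 k) ?(vallee_coef1 j k) ?subrr ?mul0r //; exact: (mono _ _ _ kj (leqnSn j)).
rewrite telescope_sumr // vallee_coef0 subr0 vallee_coef1 //.
exact: (mono _ _ _ ks (leq_trans (leq_addr _ _) sn)).
Qed.

Lemma block_majorant_ge0 j t : 0 <= block_majorant j t.
Proof.
rewrite /block_majorant.
have := fejer_ge0 (2 * half_pow j.+1) t; have := fejer_ge0 (half_pow j.+1) t.
have := fejer_ge0 (2 * half_pow j) t; have := fejer_ge0 (half_pow j) t.
lra.
Qed.

(** The four uses of [fejer_le] add up to 15 2^j, rounded up to a power of 2. *)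
Lemma block_majorant_le j t : block_majorant j t <= 16 * 2 ^+ j.
Proof.
rewrite /block_majorant.
have := fejer_le (2 * half_pow j.+1) t; have := fejer_le (half_pow j.+1) t.
have := fejer_le (2 * half_pow j) t; have := fejer_le (half_pow j) t.
have : (half_pow j)%:R <= 2 ^+ j / 2 :> R.
  by case: j => [|j] /=; rewrite ?expr0 ?mul1r ?invr_ge0 // natrX exprS mulrAC mulfV ?mul1r.
rewrite !natrM /= natrX; have : 0 <= 2 ^+ j :> R by rewrite exprn_ge0.
lra.
Qed.

Lemma vallee_norm j t : `|vallee j.+1 t| <= block_majorant j t.
Proof.
rewrite ler_norml /vallee /block_majorant.
have := fejer_ge0 (2 * half_pow j.+1) t; have := fejer_ge0 (half_pow j.+1) t.
have := fejer_ge0 (2 * half_pow j) t; have := fejer_ge0 (half_pow j) t.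
lra.
Qed.

Lemma valleeB_norm j t : `|vallee j.+1 t - vallee j t| <= block_majorant j t.
Proof.
rewrite ler_norml /vallee /block_majorant.
have := fejer_ge0 (2 * half_pow j.+1) t; have := fejer_ge0 (half_pow j.+1) t.
have := fejer_ge0 (2 * half_pow j) t; have := fejer_ge0 (half_pow j) t.
lra.
Qed.

Definition hyp_majorant n t1 t2 : R :=
  \sum_(j < n.+1) block_majorant j t1 * block_majorant (n - j) t2.

Lemma hyp_majorant_ge0 n t1 t2 : 0 <= hyp_majorant n t1 t2.
Proof. by apply: sumr_ge0 => j _; rewrite mulr_ge0 ?block_majorant_ge0. Qed.

Lemma hyp_kernel_norm n t1 t2 : `|hyp_kernel n t1 t2| <= hyp_majorant n t1 t2.
Proof.
apply: (le_trans (ler_norm_sum _ _ _)); apply: ler_sum => j _.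
by rewrite normrM ler_pM // ?valleeB_norm ?vallee_norm.
Qed.
End FejerKernel.

(** * Mean values over the torus *)

Section TorusMean.
Context {R : realType}.
Local Notation plane := (measurableTypeR R * measurableTypeR R)%type.
Local Notation period := (`[0, 2 * pi[%classic : set (measurableTypeR R)).

Definition tmean (h : R * R -> R) : R :=
  (2 * pi) ^- 2 * Rintegral (leb2 R) (@torus R) h.

(** A class closed under sums, products and absolute values, whose members are all integrable on the
    torus; it discharges every integrability condition below. *)
Definition bmeas (h : R * R -> R) :=
  measurable_fun (@torus R : set plane) (h : plane -> R) /\
  exists c, forall u, torus u -> `|h u| <= c.

Lemma measurable_torus : measurable (@torus R : set plane).
Proof. by apply: measurableX; exact: measurable_itv. Qed.

Lemma twopi_gt0 : 0 < 2 * pi :> R.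
Proof. by rewrite mulr_gt0 // pi_gt0. Qed.

Lemma lebesgue_period : lebesgue_measure period = (2 * pi)%:E :> \bar R.
Proof. by rewrite lebesgue_measure_itv /= lte_fin twopi_gt0 sube0. Qed.

Lemma leb2_torus : leb2 R (@torus R) = ((2 * pi) ^+ 2)%:E.
Proof.
have mI : measurable period by exact: measurable_itv.
have := product_measure1E (@lebesgue_measure R) (@lebesgue_measure R) mI mI.
rewrite [X in (X * X)%E]lebesgue_period -EFinM -expr2; exact.
Qed.

Lemma bmeas_integrable h : bmeas h ->
  (leb2 R).-integrable (@torus R : set plane) (EFin \o h).
Proof.
move=> [mh [c hc]]; apply: measurable_bounded_integrable => //.
- exact: measurable_torus.
- by rewrite [X in (X < _)%E]leb2_torus ltry.
- exists c; split; first exact: num_real.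
  by move=> x cx u Tu /=; rewrite (le_trans (hc _ Tu)) // ltW.
Qed.

Lemma bmeas_cst c : bmeas (fun=> c).
Proof. by split; [exact: measurable_cst | exists `|c|]. Qed.

Lemma bmeasD h1 h2 : bmeas h1 -> bmeas h2 -> bmeas (fun u => h1 u + h2 u).
Proof.
move=> [m1 [c1 h1c]] [m2 [c2 h2c]]; split; first exact: measurable_funD.
exists (c1 + c2) => u Tu; rewrite (le_trans (ler_normD _ _)) // lerD //.
  exact: h1c.
exact: h2c.
Qed.

Lemma bmeasM h1 h2 : bmeas h1 -> bmeas h2 -> bmeas (fun u => h1 u * h2 u).
Proof.
move=> [m1 [c1 h1c]] [m2 [c2 h2c]]; split; first exact: measurable_funM.
exists (c1 * c2) => u Tu; rewrite normrM ler_pM //.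
  exact: h1c.
exact: h2c.
Qed.

Lemma bmeas_sum (I : Type) (s : seq I) (h : I -> R * R -> R) :
  (forall i, bmeas (h i)) -> bmeas (fun u => \sum_(i <- s) h i u).
Proof.
move=> mh; elim: s => [|i s IH].
  by under eq_fun do rewrite big_nil; exact: bmeas_cst.
by under eq_fun do rewrite big_cons; exact: bmeasD.
Qed.

Lemma bmeas_norm h : bmeas h -> bmeas (fun u => `|h u|).
Proof.
move=> [mh [c hc]]; split; first exact: measurableT_comp.
by exists c => u Tu; rewrite normr_id hc.
Qed.

Lemma bmeas_indic (B : set plane) : measurable B -> bmeas (\1_B).
Proof.
move=> mB; split; first by apply: measurable_funTS; exact: measurable_indic.
by exists 1 => u _; rewrite indicE; case: (u \in B); rewrite ?normr1 ?normr0.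
Qed.

Lemma bmeas_fst (a : R -> R) : measurable_fun setT (a : measurableTypeR R -> R) ->
  (exists c, forall t, `|a t| <= c) -> bmeas (fun u => a u.1).
Proof.
move=> ma [c ac]; split; last by exists c.
by apply: measurable_funTS; apply: measurableT_comp => //; exact: measurable_fst.
Qed.

Lemma bmeas_snd (a : R -> R) : measurable_fun setT (a : measurableTypeR R -> R) ->
  (exists c, forall t, `|a t| <= c) -> bmeas (fun u => a u.2).
Proof.
move=> ma [c ac]; split; last by exists c.
by apply: measurable_funTS; apply: measurableT_comp => //; exact: measurable_snd.
Qed.

Lemma tmeanD h1 h2 : bmeas h1 -> bmeas h2 ->
  tmean (fun u => h1 u + h2 u) = tmean h1 + tmean h2.
Proof.
move=> b1 b2; rewrite /tmean -mulrDr; congr (_ * _).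
by apply: RintegralD; [exact: measurable_torus|exact: bmeas_integrable..].
Qed.

Lemma tmeanZ c h : bmeas h -> tmean (fun u => c * h u) = c * tmean h.
Proof.
move=> bh; rewrite /tmean mulrCA; congr (_ * _).
by apply: RintegralZl; [exact: measurable_torus|exact: bmeas_integrable].
Qed.

Lemma tmean_cst c : tmean (fun=> c) = c.
Proof.
rewrite /tmean Rintegral_cst; last exact: measurable_torus.
rewrite [fine _](_ : _ = (2 * pi) ^+ 2); last by rewrite [leb2 R _]leb2_torus.
by rewrite mulrCA mulVf ?mulr1 // expf_neq0 // gt_eqF // twopi_gt0.
Qed.

Lemma tmean_sum (I : Type) (s : seq I) (h : I -> R * R -> R) :
  (forall i, bmeas (h i)) ->
  tmean (fun u => \sum_(i <- s) h i u) = \sum_(i <- s) tmean (h i).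
Proof.
move=> mh; elim: s => [|i s IH].
  by under eq_fun do rewrite big_nil; rewrite big_nil tmean_cst.
under eq_fun do rewrite big_cons.
by rewrite big_cons tmeanD ?IH //; exact: bmeas_sum.
Qed.

Lemma le_tmean h1 h2 : bmeas h1 -> bmeas h2 ->
  (forall u, torus u -> h1 u <= h2 u) -> tmean h1 <= tmean h2.
Proof.
move=> b1 b2 h12; rewrite /tmean ler_wpM2l ?invr_ge0 ?sqr_ge0 //.
by apply: le_Rintegral => //; [exact: measurable_torus|exact: bmeas_integrable..].
Qed.

Lemma norm_tmean h : bmeas h -> `|tmean h| <= tmean (fun u => `|h u|).
Proof.
move=> bh; rewrite /tmean normrM [X in X * _]ger0_norm ?invr_ge0 ?sqr_ge0 //.
rewrite ler_wpM2l ?invr_ge0 ?sqr_ge0 //.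
by apply: le_normr_Rintegral; [exact: measurable_torus|exact: bmeas_integrable].
Qed.

Lemma tmean_indic_le (B : set plane) (r : R) : measurable B ->
  (leb2 R B <= ((2 * pi) ^+ 2 * r)%:E)%E -> tmean (\1_B) <= r.
Proof.
move=> mB Br; rewrite /tmean ler_pdivrMl ?exprn_gt0 ?twopi_gt0 //.
rewrite -lee_fin /Rintegral integral_indic //; last exact: measurable_torus.
have BT : (leb2 R (B `&` @torus R) <= ((2 * pi) ^+ 2 * r)%:E)%E.
  apply: le_trans Br; apply: le_measure; rewrite ?inE //.
  by apply: measurableI => //; exact: measurable_torus.
rewrite fineK //; rewrite ge0_fin_numE //; exact: le_lt_trans BT (ltry _).
Qed.

(** * Means of cosines over a period *)

Lemma cos_sin_twopi (k : nat) : cos (k%:R * (2 * pi)) = 1 :> R /\ sin (k%:R * (2 * pi)) = 0 :> R.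
Proof.
elim: k => [|k [IHc IHs]]; first by rewrite mul0r cos0 sin0.
rewrite -natr1 mulrDl mul1r cosD sinD IHc IHs.
have -> : 2 * pi = pi + pi :> R by ring.
rewrite cosD sinD cospi sinpi; split; ring.
Qed.

Lemma integral_cos_period (k : nat) (x : R) :
  (\int[lebesgue_measure]_(u in period) (cos (k%:R * (x - u)))%:E
   = (if k == 0%N then 2 * pi else 0)%:E)%E.
Proof.
have ccos : continuous (fun u : R => cos (k%:R * (x - u))).
  move=> u; apply: continuous_comp; last exact: continuous_cos.
  by apply: cvgM; [exact: cvg_cst|apply: cvgB; [exact: cvg_cst|exact: cvg_id]].
case: eqP => [->|/eqP k0].
  under eq_integral do rewrite mul0r cos0.
  by rewrite integral_cst //= lebesgue_period mul1e.
have kR : k%:R != 0 :> R by rewrite pnatr_eq0.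
pose F := fun u : R => - (k%:R^-1 * sin (k%:R * (x - u))).
have dF (u : R) : is_derive u 1 F (cos (k%:R * (x - u))).
  have d1 : is_derive u 1 (fun v : R => k%:R * (x - v)) (- k%:R : R).
    apply: is_derive_eq; rewrite ?scaler0 ?add0r ?addr0 ?sub0r.
    by rewrite /GRing.scale /=; ring.
  have d2 := @is_derive1_comp R (fun t => sin t) (fun v : R => k%:R * (x - v)) u _ _ (is_derive_sin _) d1.
  have d3 := is_deriveN (is_deriveZ k%:R^-1 d2).
  apply: (is_derive_eq d3).
  by rewrite /GRing.scale /=; field.
have cF : continuous F.
  move=> u; apply: differentiable_continuous; apply/derivable1_diffP.
  exact: ex_derive.
rewrite integral_itv_bndo_bndc; last first.
  apply/measurable_EFinP; apply: measurable_funTS.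
  exact: continuous_measurable_fun.
rewrite (@continuous_FTC2 _ _ F) ?twopi_gt0 //.
- rewrite /F -EFinB; congr EFin; rewrite subr0 mulrBr sinB.
  by have [-> ->] := cos_sin_twopi k; ring.
- exact: continuous_subspaceT.
- split; first by move=> u _; exact: ex_derive.
    by apply: cvg_at_right_filter; exact: cF.
  by apply: cvg_at_left_filter; exact: cF.
- by move=> u _; rewrite derive1E; exact: derive_val.
Qed.


Definition shift_cos (x : R) (k : nat) (t : R) : R := cos (k%:R * (x - t)).

Lemma measurable_shift_cos x k :
  measurable_fun setT (shift_cos x k : measurableTypeR R -> R).
Proof.
apply: continuous_measurable_fun => u.
apply: continuous_comp; last exact: continuous_cos.
by apply: cvgM; [exact: cvg_cst|apply: cvgB; [exact: cvg_cst|exact: cvg_id]].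
Qed.

Lemma shift_cos_le1 x k : exists c, forall t, `|shift_cos x k t| <= c.
Proof. by exists 1 => t; exact: cos_max. Qed.

Lemma bmeas_cos_cos x k l :
  bmeas (fun u => shift_cos x.1 k u.1 * shift_cos x.2 l u.2).
Proof.
apply: bmeasM.
  by apply: bmeas_fst; [exact: measurable_shift_cos|exact: shift_cos_le1].
by apply: bmeas_snd; [exact: measurable_shift_cos|exact: shift_cos_le1].
Qed.

Lemma tmean_cos_cos x k l :
  tmean (fun u => shift_cos x.1 k u.1 * shift_cos x.2 l u.2)
  = ((k == 0%N) && (l == 0%N))%:R.
Proof.
set h := fun u => _; have bh : bmeas h := bmeas_cos_cos x k l.
pose c (m : nat) : R := if m == 0%N then 2 * pi else 0.
have mI : measurable period by exact: measurable_itv.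
have intc y m : (@lebesgue_measure R).-integrable period (EFin \o shift_cos y m).
  apply: (measurable_bounded_integrable mI).
  - by rewrite [X in (X < _)%E]lebesgue_period ltry.
  - exact: measurable_funTS (measurable_shift_cos _ _).
  - exists 1; split; first exact: num_real.
    by move=> z z1 u _ /=; rewrite (le_trans (cos_max _)) // ltW.
have I12 : (\int[leb2 R]_(u in @torus R) (h u)%:E = (c k * c l)%:E)%E.
  rewrite integral_mkcond.
  have fint : (lebesgue_measure \x lebesgue_measure)%E.-integrable
      [set: plane] ((EFin \o h) \_ (@torus R : set plane)).
    by have := bmeas_integrable _ bh; rewrite (integrable_mkcond _ measurable_torus).
  rewrite -[LHS](integral12_prod_meas1 fint) /fubini_F.
  transitivity (\int[lebesgue_measure]_(s in period) ((shift_cos x.1 k s)%:E * (c l)%:E))%E.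
    rewrite [RHS]integral_mkcond; apply: eq_integral => s _.
    rewrite [RHS]patchE; case: ifPn => sI.
      rewrite /c -(integral_cos_period l x.2) -integralZl //; last exact: intc.
      rewrite [RHS]integral_mkcond; apply: eq_integral => t _.
      rewrite !patchE /torus in_setX sI /=.
      by case: ifP.
    apply: (etrans _ (integral0 (@lebesgue_measure R) setT)).
    apply: eq_integral => t _.
    by rewrite patchE /torus in_setX (negbTE sI).
  rewrite integralZr //; last exact: intc.
  by rewrite [X in (X * _)%E](integral_cos_period k x.1) -EFinM.
rewrite /tmean /Rintegral I12 /= /c.
have p0 : 2 * pi != 0 :> R by rewrite gt_eqF // twopi_gt0.
by case: (k == 0%N); case: (l == 0%N); rewrite ?mul0r ?mulr0 // -expr2 mulVf // expf_neq0.
Qed.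

End TorusMean.

(** * Mean values of the kernels *)

Section KernelMeans.
Context {R : realType}.
Local Notation plane := (measurableTypeR R * measurableTypeR R)%type.
Implicit Types (x u : R * R) (N M n i j k l : nat).

Lemma bmeas_fejer1 x N : bmeas (fun u => fejer N (x.1 - u.1)).
Proof.
under eq_fun do rewrite (fejerE _ _ _ (leqnn N)).
apply: bmeas_sum => i; apply: bmeasM; first exact: bmeas_cst.
by apply: (bmeas_fst (shift_cos x.1 i)); [exact: measurable_shift_cos|exact: shift_cos_le1].
Qed.

Lemma bmeas_fejer2 x N : bmeas (fun u => fejer N (x.2 - u.2)).
Proof.
under eq_fun do rewrite (fejerE _ _ _ (leqnn N)).
apply: bmeas_sum => i; apply: bmeasM; first exact: bmeas_cst.
by apply: (bmeas_snd (shift_cos x.2 i)); [exact: measurable_shift_cos|exact: shift_cos_le1].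
Qed.

Lemma bmeas_fejer x N M :
  bmeas (fun u => fejer N (x.1 - u.1) * fejer M (x.2 - u.2)).
Proof. by apply: bmeasM; [exact: bmeas_fejer1|exact: bmeas_fejer2]. Qed.

Lemma fejer_tensorE x u N M L : (N <= L)%N -> (M <= L)%N ->
  fejer N (x.1 - u.1) * fejer M (x.2 - u.2) = \sum_(k < L) \sum_(l < L)
    (cosw k * cosw l * (fejer_coef N k * fejer_coef M l)) *
      (shift_cos x.1 k u.1 * shift_cos x.2 l u.2).
Proof.
move=> NL ML; rewrite (fejerE N L) // (fejerE M L) // mulr_suml.
apply: eq_bigr => k _; rewrite mulr_sumr; apply: eq_bigr => l _.
by rewrite /shift_cos; ring.
Qed.

Lemma tmean_fejer x N M : (0 < N)%N -> (0 < M)%N ->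
  tmean (fun u => fejer N (x.1 - u.1) * fejer M (x.2 - u.2)) = 1.
Proof.
(* N + M bounds both orders; writing it as a successor splits off the frequency 0, the only one with
   a nonzero mean. *)
move=> N0 M0; pose L := (N + M).-1.
have L1 : (N + M = L.+1)%N by rewrite prednK // addn_gt0 N0.
under eq_fun do rewrite (fejer_tensorE _ _ _ _ L.+1) -?L1 ?leq_addr ?leq_addl //.
have bc c k l : bmeas (fun u => c * (shift_cos x.1 k u.1 * shift_cos x.2 l u.2)).
  by apply: bmeasM; [exact: bmeas_cst|exact: bmeas_cos_cos].
rewrite tmean_sum; last by move=> k; apply: bmeas_sum => l; exact: bc.
rewrite L1 big_ord_recl /= [X in _ + X]big1 ?addr0.
  rewrite tmean_sum // big_ord_recl [X in _ + X]big1 ?addr0.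
    rewrite tmeanZ; last exact: bmeas_cos_cos.
    rewrite tmean_cos_cos /= /cosw /= mulr1 !mul1r !fejer_coef1B //.
    by rewrite !mul0r !subr0 !mulr1.
  move=> l _; rewrite tmeanZ; last exact: bmeas_cos_cos.
  by rewrite tmean_cos_cos /= mulr0.
move=> k _; rewrite tmean_sum // big1 // => l _.
rewrite tmeanZ; last exact: bmeas_cos_cos.
by rewrite tmean_cos_cos /= mulr0.
Qed.

(** The inequality includes order 0, where the kernel vanishes; this occurs in H_0, as [half_pow 0]
    is 0. *)
Lemma tmean_fejer_le1 x N M :
  tmean (fun u => fejer N (x.1 - u.1) * fejer M (x.2 - u.2)) <= 1.
Proof.
have f0 t : fejer 0 t = 0 :> R by rewrite /fejer invr0 mul0r.
case: N => [|N].
  by under eq_fun do rewrite f0 mul0r; rewrite tmean_cst.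
case: M => [|M]; last by rewrite tmean_fejer.
by under eq_fun do rewrite f0 mulr0; rewrite tmean_cst.
Qed.

Lemma bmeas_block1 x j : bmeas (fun u => block_majorant j (x.1 - u.1)).
Proof.
rewrite /block_majorant; apply: bmeasD; (apply: bmeasD; last exact: bmeas_fejer1);
  by apply: bmeasM; [exact: bmeas_cst|exact: bmeas_fejer1].
Qed.

Lemma bmeas_block2 x j : bmeas (fun u => block_majorant j (x.2 - u.2)).
Proof.
rewrite /block_majorant; apply: bmeasD; (apply: bmeasD; last exact: bmeas_fejer2);
  by apply: bmeasM; [exact: bmeas_cst|exact: bmeas_fejer2].
Qed.

Lemma tmean_block x i j :
  tmean (fun u => block_majorant i (x.1 - u.1) * block_majorant j (x.2 - u.2)) <= 36.
Proof.
(* The weights of a majorant add up to 2 + 1 + 2 + 1 = 6. Applying this once in each variable gives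
   36. *)
have comb (h1 h2 h3 h4 h : R * R -> R) (c : R) :
    bmeas h1 -> bmeas h2 -> bmeas h3 -> bmeas h4 -> bmeas h ->
    tmean (fun u => h1 u * h u) <= c -> tmean (fun u => h2 u * h u) <= c ->
    tmean (fun u => h3 u * h u) <= c -> tmean (fun u => h4 u * h u) <= c ->
    tmean (fun u => (2 * h1 u + h2 u + (2 * h3 u + h4 u)) * h u) <= 6 * c.
  move=> b1 b2 b3 b4 b; have m h' : bmeas h' -> bmeas (fun u => h' u * h u).
    by move=> b'; exact: bmeasM.
  have m2 h' : bmeas h' -> bmeas (fun u => 2 * (h' u * h u)).
    by move=> b'; apply: bmeasM; [exact: bmeas_cst|exact: m].
  have -> : (fun u => (2 * h1 u + h2 u + (2 * h3 u + h4 u)) * h u) =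
      (fun u => 2 * (h1 u * h u) + h2 u * h u + (2 * (h3 u * h u) + h4 u * h u)).
    by apply/funext => u; ring.
  rewrite !tmeanD ?tmeanZ //; try (exact: m); try (exact: m2).
  - lra.
  - by apply: bmeasD; [exact: m2|exact: m].
  - by apply: bmeasD; [exact: m2|exact: m].
have half N : tmean (fun u => fejer N (x.1 - u.1) * block_majorant j (x.2 - u.2)) <= 6 * 1.
  under eq_fun do rewrite mulrC.
  apply: comb; try exact: bmeas_fejer2; first exact: bmeas_fejer1;
  by under eq_fun do rewrite mulrC; exact: tmean_fejer_le1.
have -> : 36 = 6 * (6 * 1) :> R by ring.
by apply: comb; try exact: bmeas_fejer1; [exact: bmeas_block2|exact: half..].
Qed.

Definition block_tensor n x i u : R :=
  block_majorant i (x.1 - u.1) * block_majorant (n - i) (x.2 - u.2).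

Lemma bmeas_block_tensor n x i : bmeas (block_tensor n x i).
Proof. by apply: bmeasM; [exact: bmeas_block1|exact: bmeas_block2]. Qed.

Lemma bmeas_hyp_majorant n x :
  bmeas (fun u => hyp_majorant n (x.1 - u.1) (x.2 - u.2)).
Proof. by apply: bmeas_sum => i; exact: bmeas_block_tensor. Qed.

Lemma tmean_hyp_majorant n x :
  tmean (fun u => hyp_majorant n (x.1 - u.1) (x.2 - u.2)) <= 36 * n.+1%:R.
Proof.
rewrite tmean_sum; last by move=> i; exact: (bmeas_block_tensor n x i).
rewrite -[n.+1 in leRHS]card_ord mulr_natr -sumr_const.
by apply: ler_sum => i _; exact: tmean_block.
Qed.

(** The tensor of index i lives on a rectangle of sides about 2^(-i) and 2^(-(n-i)). For i <= j, the
    rectangles of i and j meet in an area smaller by 2^(-(j-i)) than that of either, which is the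
    gain; the tensor of index k only contributes its supremum 16^2 2^n. *)
Lemma tmean_block_triple_ordered n x i j k :
  (i <= j)%N -> (j <= n)%N -> (k <= n)%N ->
  tmean (fun u => block_tensor n x i u * block_tensor n x j u * block_tensor n x k u)
  <= 36 * 16 ^+ 4 * 4 ^+ n * (1 / 2) ^+ (j - i).
Proof.
move=> ij jn kn.
have E : 16 ^+ 4 * 4 ^+ n * (1 / 2) ^+ (j - i) =
   (16 * 2 ^+ i) * (16 * 2 ^+ k) * ((16 * 2 ^+ (n - j)) * (16 * 2 ^+ (n - k))) :> R.
  have e1 : 2 ^+ n = 2 ^+ (n - j) * (2 ^+ (j - i) * 2 ^+ i) :> R by rewrite -!exprD !subnK.
  have e2 : 2 ^+ n = 2 ^+ (n - k) * 2 ^+ k :> R by rewrite -exprD subnK.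
  have -> : 4 ^+ n = 2 ^+ n * 2 ^+ n :> R by rewrite -exprMn; congr (_ ^+ n); ring.
  rewrite {1}e1 e2 expr_div_n expr1n.
  have : 2 ^+ (j - i) != 0 :> R by rewrite expf_neq0.
  move: (2 ^+ (j - i)) (2 ^+ i) (2 ^+ (n - j)) (2 ^+ k) (2 ^+ (n - k)) => p q r s t p0.
  by field.
rewrite -(mulrA 36) -(mulrA 36) E.
set c := (X in 36 * X).
(* The factor i is left unbounded in the second variable and the factor j in
   the first one; the others are replaced by their suprema. *)
apply: (@le_trans _ _ (tmean (fun u => c *
   (block_majorant j (x.1 - u.1) * block_majorant (n - i) (x.2 - u.2))))).
  apply: le_tmean.
  - by apply: bmeasM; [apply: bmeasM|]; exact: bmeas_block_tensor.
  - apply: bmeasM; first exact: bmeas_cst.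
    by apply: bmeasM; [exact: bmeas_block1|exact: bmeas_block2].
  move=> u _; rewrite /block_tensor /c.
  have b0 m t : 0 <= block_majorant m t :> R by exact: block_majorant_ge0.
  have bl m t : block_majorant m t <= 16 * 2 ^+ m :> R by exact: block_majorant_le.
  set a1 := block_majorant i _; set a2 := block_majorant j _; set a3 := block_majorant k _.
  set d1 := block_majorant (n - i) _; set d2 := block_majorant (n - j) _.
  set d3 := block_majorant (n - k) _.
  rewrite [leLHS](_ : _ = ((a1 * a3) * (d2 * d3)) * (a2 * d1)); last by ring.
  rewrite ler_wpM2r ?mulr_ge0 ?b0 //.
  by apply: ler_pM; rewrite ?mulr_ge0 ?b0 //; apply: ler_pM; rewrite ?b0 ?bl.
rewrite tmeanZ; last by apply: bmeasM; [exact: bmeas_block1|exact: bmeas_block2].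
rewrite mulrC ler_wpM2r ?tmean_block // /c.
by rewrite !mulr_ge0 // exprn_ge0.
Qed.

(** The number 3/4 is a rational substitute for the square root of 1/2, as 9/16 >= 1/2. It lets a
    decay in one distance be shared between two. *)
Lemma expr_half_le m p : (m <= 2 * p)%N -> (1 / 2) ^+ p <= (3 / 4) ^+ m :> R.
Proof.
move=> mp; apply: (@le_trans _ _ ((3 / 4) ^+ (2 * p))).
  by rewrite exprM lerXn2r ?nnegrE //; lra.
by apply: ler_wiXn2l => //; lra.
Qed.

(** If p is the larger of |i - j| and |j - k|, then |i - j| + |j - k| <= 2 p, and the ordered
    estimate is applied to the pair at distance p. The bound becomes a product, so that i and k can
    be summed separately around the pivot j. *)
Lemma tmean_block_triple n x i j k :
  (i <= n)%N -> (j <= n)%N -> (k <= n)%N ->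
  tmean (fun u => block_tensor n x i u * block_tensor n x j u * block_tensor n x k u)
  <= 36 * 16 ^+ 4 * 4 ^+ n *
     ((3 / 4) ^+ ((i - j) + (j - i)) * (3 / 4) ^+ ((j - k) + (k - j))).
Proof.
move=> i_n jn kn; set w := block_tensor n x.
have C0 : 0 <= 36 * 16 ^+ 4 * 4 ^+ n :> R by rewrite !mulr_ge0 // exprn_ge0.
have main a b c p : (a <= n)%N -> (b <= n)%N -> (c <= n)%N ->
    (i - j + (j - i) + (j - k + (k - j)) <= 2 * p)%N -> (p = (a - b) + (b - a))%N ->
    (forall u, w i u * w j u * w k u = w a u * w b u * w c u) ->
    tmean (fun u => w i u * w j u * w k u) <=
    36 * 16 ^+ 4 * 4 ^+ n * ((3 / 4) ^+ (i - j + (j - i)) * (3 / 4) ^+ (j - k + (k - j))).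
  move=> an bn cn le_p pE wE; rewrite -exprD.
  apply: (@le_trans _ _ (36 * 16 ^+ 4 * 4 ^+ n * (1 / 2) ^+ p)); last first.
    by rewrite ler_wpM2l // expr_half_le.
  under eq_fun do rewrite wE.
  have [ab|ba] := leqP a b.
    have -> : p = (b - a)%N by rewrite pE; move: ab; rewrite -subn_eq0 => /eqP ->.
    exact: tmean_block_triple_ordered.
  have -> : p = (a - b)%N by rewrite pE; move: (ltnW ba); rewrite -subn_eq0 => /eqP ->; rewrite addn0.
  under eq_fun do rewrite (mulrC (w a _)).
  by apply: tmean_block_triple_ordered => //; exact: ltnW.
have [d|d] := leqP (j - k + (k - j)) (i - j + (j - i)).
  by apply: (main i j k _ i_n jn kn _ erefl) => //; rewrite mul2n -addnn leq_add2l.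
apply: (main j k i _ jn kn i_n _ erefl); last by move=> u; ring.
by rewrite mul2n -addnn leq_add2r ltnW.
Qed.

Lemma sum_geometric_dist j m :
  \sum_(i < m) (3 / 4) ^+ ((i - j) + (j - i)) <= 8 :> R.
Proof.
(* A bound on the partial sums that the induction on m can carry: each side of j contributes a
   geometric series of sum at most 4 = 1 / (1 - 3/4). *)
pose b := if (m <= j.+1)%N then 4 * (3 / 4) ^+ (j.+1 - m)
          else 8 - 4 * (3 / 4) ^+ (m - j.+1) : R.
have pow01 p : 0 <= ((3 / 4) ^+ p : R) <= 1.
  by rewrite exprn_ge0 ?exprn_ile1 //; lra.
apply: (@le_trans _ _ b); last first.
  by rewrite /b; case: ifP => _; [have := pow01 (j.+1 - m)%N|have := pow01 (m - j.+1)%N]; lra.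
rewrite {}/b; elim: m => [|m IH].
  by rewrite big_ord0 leq0n subn0 mulr_ge0 // exprn_ge0; lra.
rewrite big_ord_recr /=; apply: (le_trans (lerD IH (lexx _))).
have [mj|jm] := leqP m.+1 j.+1.
  rewrite ltnW // subSS.
  have -> : (m - j = 0)%N by apply/eqP; rewrite subn_eq0 -ltnS.
  by rewrite add0n subSn // exprS; have := pow01 (j - m)%N; lra.
have jm' : (j < m)%N by rewrite -ltnS.
have -> : (j - m = 0)%N by apply/eqP; rewrite subn_eq0 ltnW.
have -> : (m - j = (m - j.+1).+1)%N by rewrite subnSK.
have [mj1|_] := leqP m j.+1.
  have -> : m = j.+1 by apply/eqP; rewrite eqn_leq mj1.
  by rewrite subnn subSnn expr0 addn0 !expr1; lra.
by rewrite addn0 (subSn jm') exprS; have := pow01 (m - j.+1)%N; lra.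
Qed.

(** The constant of [tmean_block_triple] times 8 * 8, for the sums over i and k. *)
Definition cube_const : R := 36 * 16 ^+ 4 * 64.

Lemma tmean_hyp_majorant_cube n x :
  tmean (fun u => hyp_majorant n (x.1 - u.1) (x.2 - u.2) ^+ 3)
  <= cube_const * 4 ^+ n * n.+1%:R.
Proof.
pose w := block_tensor n x.
(* The pivot j is put outermost: the inner sums are then bounded uniformly in j, and only j costs a
   factor n + 1. *)
have -> : (fun u => hyp_majorant n (x.1 - u.1) (x.2 - u.2) ^+ 3) =
    (fun u => \sum_(j < n.+1) \sum_(i < n.+1) \sum_(k < n.+1) w i u * w j u * w k u).
  apply/funext => u; rewrite /hyp_majorant -/(w _ u).
  rewrite exprS expr2 [LHS]mulrCA [LHS]mulr_suml; apply: eq_bigr => j _.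
  rewrite mulrCA mulr_suml; apply: eq_bigr => i _.
  rewrite mulrA mulr_sumr; apply: eq_bigr => k _.
  by rewrite /w /block_tensor; ring.
have bw i j k : bmeas (fun u => w i u * w j u * w k u).
  by apply: bmeasM; [apply: bmeasM|]; exact: bmeas_block_tensor.
have bw1 i j : bmeas (fun u => \sum_(k < n.+1) w i u * w j u * w k u).
  by apply: bmeas_sum.
rewrite tmean_sum; last by move=> j; exact: bmeas_sum.
rewrite mulr_natr -[n.+1 in leRHS]card_ord -sumr_const; apply: ler_sum => j _.
rewrite tmean_sum //.
have -> : cube_const * 4 ^+ n = 36 * 16 ^+ 4 * 4 ^+ n * (8 * 8) by rewrite /cube_const; ring.
have C0 : 0 <= 36 * 16 ^+ 4 * 4 ^+ n :> R by rewrite !mulr_ge0 // exprn_ge0.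
pose d i := (3 / 4) ^+ ((i - j) + (j - i)) : R.
have d0 i : 0 <= d i by rewrite exprn_ge0; lra.
apply: (@le_trans _ _ (36 * 16 ^+ 4 * 4 ^+ n * ((\sum_(i < n.+1) d i) * (\sum_(k < n.+1) d k)))); last first.
  rewrite ler_wpM2l // ler_pM ?sum_geometric_dist //; exact: sumr_ge0.
rewrite mulr_suml mulr_sumr; apply: ler_sum => i _.
rewrite tmean_sum // mulr_sumr mulr_sumr; apply: ler_sum => k _.
rewrite /d (addnC (k - j)%N); apply: tmean_block_triple; exact: leq_ord.
Qed.

End KernelMeans.

(** * The reproducing formula *)

Section Reproducing.
Context {R : realType}.
Local Notation plane := (measurableTypeR R * measurableTypeR R)%type.
Implicit Types (x u : R * R) (N M n i j k l : nat).

(** Means are taken over one fundamental square, so the peak of a kernel centred at x is seen whole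
    when x is interior. The other points are reached by density in [open_square_dense]. *)
Definition open_square : set (R * R) := `]0, 2 * pi[ `*` `]0, 2 * pi[.

Lemma cos_le_away (a d : R) : 0 < d <= pi -> d <= a <= 2 * pi - d -> cos a <= cos d.
Proof.
move=> /andP[d0 dpi] /andP[da ad].
have cmono b : d <= b -> b <= pi -> cos b <= cos d.
  rewrite le_eqVlt => /predU1P[-> //|db] bpi; apply/ltW.
  by rewrite ltr_cos // in_itv /= ?(ltW d0) ?dpi // bpi andbT ltW // (lt_trans d0).
have [api|pia] := leP a pi; first exact: cmono.
have -> : cos a = cos (2 * pi - a).
  have := @cos_sin_twopi R 1; rewrite mul1r => -[c1 s1].
  by rewrite cosB c1 s1; ring.
by apply: cmono; lra.
Qed.

Lemma cos_gap (y d : R) : 0 < y < 2 * pi -> 0 < d ->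
  exists2 e : R, 0 < e & forall t, 0 <= t < 2 * pi -> d <= `|y - t| ->
    e <= 1 - cos (y - t).
Proof.
move=> /andP[y0 y2] d0; have pi0 := pi_gt0 R.
(* For t in the period, |y - t| is at most max(y, 2 pi - y), hence at most 2 pi - m; this keeps it
   away from the next peak of the cosine. *)
pose m := Num.min (Num.min d pi) (Num.min y (2 * pi - y)).
have m0 : 0 < m by rewrite /m !lt_min; lra.
have [md mpi my my2] : [/\ m <= d, m <= pi, m <= y & m <= 2 * pi - y].
  by rewrite /m !ge_min !lexx ?orbT.
exists (1 - cos m).
  have := @ltr_cos R 0 m; rewrite cos0 subr_gt0 => ->//.
    by rewrite in_itv /= lexx ltW.
  by rewrite in_itv /= ltW // mpi.
move=> t /andP[t0 t2] dt; rewrite lerD2l lerN2.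
have cn : cos (y - t) = cos `|y - t|.
  by have [h|h] := leP 0 (y - t); [rewrite ger0_norm|rewrite ltr0_norm // cosN].
rewrite cn; apply: cos_le_away; first by rewrite m0.
rewrite (le_trans md dt) /= ler_norml; lra.
Qed.

Section FixedFunction.
Variables (n : nat) (g : R * R -> R).
Hypothesis bg : bmeas g.
Hypothesis gQ : forall k l x, ~ Q n (Posz k, Posz l) ->
  tmean (fun u => g u * (shift_cos x.1 k u.1 * shift_cos x.2 l u.2)) = 0.

(** Continuity at x and boundedness give |g x - g u| <= e + K ((1 - cos(x1 - u1)) + (1 - cos(x2 -
    u2))), and [fejer_decay] turns each cosine term into 2 K / N after averaging. [C] may depend on
    x and e, but not on N. *)
Lemma fejer_approx x (e : R) : open_square x -> {for x, continuous g} -> 0 < e ->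
  exists C : R, forall N, (0 < N)%N ->
   `|g x - tmean (fun u => g u * (fejer N (x.1 - u.1) * fejer N (x.2 - u.2)))|
     <= e + C / N%:R.
Proof.
case: x => x1 x2 [/= X1 X2] gc e0.
rewrite /= !in_itv /= in X1 X2.
have [d d0 gd] : exists2 d : R, 0 < d & forall u, `|x1 - u.1| < d -> `|x2 - u.2| < d ->
    `|g (x1, x2) - g u| < e.
  have /cvgrPdist_lt /(_ e e0) := gc.
  move=> /nbhs_ballP[d /= d0 H]; exists d => // u u1 u2.
  by apply: H; split.
have [e1 e10 H1] := cos_gap _ _ X1 d0; have [e2 e20 H2] := cos_gap _ _ X2 d0.
have [mg [c gc']] := bg.
pose K := (`|g (x1, x2)| + c) / e1 + (`|g (x1, x2)| + c) / e2.
have c0 : 0 <= c.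
  apply: (le_trans (normr_ge0 (g (x1, x2)))); apply: gc'.
  by split => /=; rewrite in_itv /=; [case/andP: X1 => /ltW -> ->|case/andP: X2 => /ltW -> ->].
have c1 : 0 <= `|g (x1, x2)| + c by rewrite addr_ge0.
have cos1 (t : R) : 0 <= 1 - cos t by have := cos_le1 t; lra.
have K0 : 0 <= K by rewrite addr_ge0 // divr_ge0 // ltW.
(* As x is interior, the cosines equal 1 on the square only at u = x. *)
have osc u : torus u -> `|g (x1, x2) - g u| <= e + K * ((1 - cos (x1 - u.1)) + (1 - cos (x2 - u.2))).
  move=> Tu; have [U1 U2] := Tu; rewrite /= !in_itv /= in U1 U2.
  have gle : `|g (x1, x2) - g u| <= `|g (x1, x2)| + c.
    by rewrite (le_trans (ler_normB _ _)) // lerD2l gc'.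
  have a1 := cos1 (x1 - u.1); have a2 := cos1 (x2 - u.2).
  have K1 : 0 <= (`|g (x1, x2)| + c) / e1 by rewrite divr_ge0 // ltW.
  have K2 : 0 <= (`|g (x1, x2)| + c) / e2 by rewrite divr_ge0 // ltW.
  have far (ee a b : R) : 0 < ee -> ee <= a -> 0 <= b -> `|g (x1, x2) - g u| <= e + (`|g (x1, x2)| + c) / ee * (a + b).
    move=> ee0 eea b0; apply: (le_trans gle).
    have : (`|g (x1, x2)| + c) <= (`|g (x1, x2)| + c) / ee * (a + b).
      rewrite -mulrA ler_peMr // mulrC ler_pdivlMr // mul1r; lra.
    by move=> h; lra.
  have [n1|f1] := ltP `|x1 - u.1| d.
    have [n2|f2] := ltP `|x2 - u.2| d.
      rewrite (le_trans (ltW (gd _ n1 n2))) // lerDl mulr_ge0 // (addr_ge0 a1 a2).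
    apply: (le_trans (far _ _ _ e20 (H2 _ U2 f2) a1)).
    by rewrite lerD2l [X in _ <= _ * X]addrC ler_wpM2r ?(addr_ge0 a2 a1) // /K lerDr.
  apply: (le_trans (far _ _ _ e10 (H1 _ U1 f1) a2)).
  by rewrite lerD2l ler_wpM2r ?(addr_ge0 a1 a2) // /K lerDl.
exists (K * 4) => N N0.
pose F u := fejer N (x1 - u.1) * fejer N (x2 - u.2).
have bF : bmeas F by exact: (bmeas_fejer (x1, x2)).
have F0 u : 0 <= F u by rewrite mulr_ge0 ?fejer_ge0.
have mF : tmean F = 1 by exact: (tmean_fejer (x1, x2)).
have bgF : bmeas (fun u => g u * F u) by exact: bmeasM.
have -> : g (x1, x2) - tmean (fun u => g u * F u) =
    tmean (fun u => (g (x1, x2) - g u) * F u).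
  have -> : (fun u => (g (x1, x2) - g u) * F u) =
      (fun u => g (x1, x2) * F u + -1 * (g u * F u)).
    by apply/funext => u; ring.
  rewrite tmeanD; [|by apply: bmeasM => //; exact: bmeas_cst..].
  by rewrite !tmeanZ // mF mulr1 mulN1r.
have bdiff : bmeas (fun u => (g (x1, x2) - g u) * F u).
  apply: bmeasM => //; under eq_fun do rewrite -(mulN1r (g _)).
  apply: bmeasD; first exact: bmeas_cst.
  by apply: bmeasM; first exact: bmeas_cst.
apply: (le_trans (norm_tmean _ bdiff)).
(* As [fejer 1] is the constant 1, [F1] and [F2] are one-variable kernels written as tensors, so
   [tmean_fejer] gives them mean 1. *)
pose F1 u := fejer 1 (x1 - u.1) * fejer N (x2 - u.2).
pose F2 u := fejer N (x1 - u.1) * fejer 1 (x2 - u.2).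
have bF1 : bmeas F1 by exact: (bmeas_fejer (x1, x2)).
have bF2 : bmeas F2 by exact: (bmeas_fejer (x1, x2)).
have fejer1 t : fejer 1 t = 1 :> R.
  by rewrite /fejer !big_ord1 mul0r cos0 sin0 invr1 expr1n expr0n addr0 mulr1.
apply: (@le_trans _ _ (tmean (fun u => e * F u + K * (2 / N%:R) * (F1 u + F2 u)))).
  apply: le_tmean.
  - exact: bmeas_norm.
  - apply: bmeasD; apply: bmeasM => //; try exact: bmeas_cst.
    exact: bmeasD.
  move=> u Tu; rewrite normrM (ger0_norm (F0 u)).
  apply: (le_trans (ler_wpM2r (F0 u) (osc u Tu))).
  have h1 : (1 - cos (x1 - u.1)) * F u <= 2 / N%:R * F1 u.
    rewrite /F /F1 fejer1 mul1r mulrA ler_wpM2r ?fejer_ge0 //.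
    exact: fejer_decay.
  have h2 : (1 - cos (x2 - u.2)) * F u <= 2 / N%:R * F2 u.
    rewrite /F /F2 fejer1 mulr1 mulrCA mulrC ler_wpM2r ?fejer_ge0 //.
    exact: fejer_decay.
  rewrite mulrDl lerD2l -!(mulrA K) ler_wpM2l // mulrDl [leRHS]mulrDr.
  exact: lerD.
rewrite tmeanD; first last.
- by apply: bmeasM; [exact: bmeas_cst|exact: bmeasD].
- by apply: bmeasM; [exact: bmeas_cst|].
rewrite !tmeanZ ?tmeanD ?mF //; last exact: bmeasD.
rewrite (tmean_fejer (x1, x2)) // (tmean_fejer (x1, x2)) // mulr1 lerD2l.
by rewrite le_eqVlt; apply/orP; left; apply/eqP; ring.
Qed.

Definition freq_mean x k l : R :=
  tmean (fun u => g u * (shift_cos x.1 k u.1 * shift_cos x.2 l u.2)).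

Lemma tmean_cos_expansion x L (c : nat -> nat -> R) :
  tmean (fun u => g u * \sum_(k < L) \sum_(l < L)
      c k l * (shift_cos x.1 k u.1 * shift_cos x.2 l u.2))
  = \sum_(k < L) \sum_(l < L) c k l * freq_mean x k l.
Proof.
have b1 k l : bmeas (fun u => g u * (shift_cos x.1 k u.1 * shift_cos x.2 l u.2)).
  by apply: bmeasM => //; exact: bmeas_cos_cos.
have b k l : bmeas (fun u => c k l * (g u * (shift_cos x.1 k u.1 * shift_cos x.2 l u.2))).
  by apply: bmeasM => //; exact: bmeas_cst.
have -> : (fun u => g u * \sum_(k < L) \sum_(l < L)
      c k l * (shift_cos x.1 k u.1 * shift_cos x.2 l u.2)) =
   (fun u => \sum_(k < L) \sum_(l < L)
      c k l * (g u * (shift_cos x.1 k u.1 * shift_cos x.2 l u.2))).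
  apply/funext => u; rewrite mulr_sumr; apply: eq_bigr => k _.
  by rewrite mulr_sumr; apply: eq_bigr => l _; rewrite mulrCA.
rewrite tmean_sum; last by move=> k; exact: bmeas_sum.
apply: eq_bigr => k _; rewrite tmean_sum //; apply: eq_bigr => l _.
by rewrite tmeanZ.
Qed.

Lemma Q_dyadic k l : Q n (Posz k, Posz l) ->
  exists s1 s2, [/\ (s1 + s2 <= n)%N, (k < 2 ^ s1)%N & (l < 2 ^ s2)%N].
Proof.
move=> [[s1 s2] /= sn [/= /andP[_ ks] /andP[_ ls]]].
by exists s1, s2.
Qed.

Lemma hyp_coef_Q k l : Q n (Posz k, Posz l) -> hyp_coef n k l = 1 :> R.
Proof.
move=> /Q_dyadic[s1 [s2 [sn ks ls]]].
by apply: (hyp_coef1 n s1 s2) => //; exact: ltnW.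
Qed.

Lemma Q_lt k l : Q n (Posz k, Posz l) -> (k < 2 ^ n.+1)%N /\ (l < 2 ^ n.+1)%N.
Proof.
move=> /Q_dyadic[s1 [s2 [sn ks ls]]].
have s1n : (s1 <= n.+1)%N by rewrite (leq_trans (leq_addr s2 _)) // (leq_trans sn).
have s2n : (s2 <= n.+1)%N by rewrite (leq_trans (leq_addl s1 _)) // (leq_trans sn).
by split; [apply: (leq_trans ks)|apply: (leq_trans ls)]; rewrite leq_exp2l.
Qed.

Lemma freq_mean0 x k l : ~ Q n (Posz k, Posz l) -> freq_mean x k l = 0.
Proof. by move=> nQ; exact: gQ. Qed.

Lemma sum_ord_trunc (F : nat -> R) L N : (L <= N)%N ->
  (forall k, (L <= k)%N -> F k = 0) -> \sum_(k < N) F k = \sum_(k < L) F k.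
Proof.
move=> LN F0; rewrite -(subnKC LN) big_split_ord /= [X in _ + X]big1 ?addr0 //.
by move=> i _; rewrite F0 // leq_addr.
Qed.

(** The range of summation does not depend on N, so N can later grow term by term. *)
Lemma tmean_fejer_trunc x N : (2 ^ n.+1 <= N)%N ->
  tmean (fun u => g u * (fejer N (x.1 - u.1) * fejer N (x.2 - u.2)))
  = \sum_(k < 2 ^ n.+1) \sum_(l < 2 ^ n.+1)
     cosw k * cosw l * (fejer_coef N k * fejer_coef N l) * freq_mean x k l.
Proof.
move=> LN; under eq_fun do rewrite (fejer_tensorE _ _ _ _ N) //.
rewrite (tmean_cos_expansion x N (fun k l => cosw k * cosw l * (fejer_coef N k * fejer_coef N l))).
rewrite (sum_ord_trunc (fun k => \sum_(l < N) cosw k * cosw l *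
  (fejer_coef N k * fejer_coef N l) * freq_mean x k l) _ _ LN).
  apply: eq_bigr => k _.
  rewrite (sum_ord_trunc (fun l => cosw k * cosw l *
    (fejer_coef N k * fejer_coef N l) * freq_mean x k l) _ _ LN) //.
  move=> l Ll; rewrite freq_mean0 ?mulr0 // => /Q_lt[_].
  by rewrite ltnNge Ll.
move=> k Lk; apply: big1 => l _; rewrite freq_mean0 ?mulr0 // => /Q_lt[].
by rewrite ltnNge Lk.
Qed.

Lemma tmean_hyp_kernel x :
  tmean (fun u => g u * hyp_kernel n (x.1 - u.1) (x.2 - u.2))
  = \sum_(k < 2 ^ n.+1) \sum_(l < 2 ^ n.+1) cosw k * cosw l * freq_mean x k l.
Proof.
under eq_fun do rewrite (hyp_kernelE _ _ _ _ (leqnn _)).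
rewrite (tmean_cos_expansion x (2 ^ n.+1) (fun k l => cosw k * cosw l * hyp_coef n k l)).
apply: eq_bigr => k _; apply: eq_bigr => l _.
have [kl|/freq_mean0->] := pselect (Q n (Posz k, Posz l)).
  by rewrite hyp_coef_Q // mulr1.
by rewrite !mulr0.
Qed.

(** In a Fejer mean of g the weights on the frequencies of Q_n tend to 1, the value they have in K,
    while the mean itself tends to g x. Both errors are O(1/N). *)
Lemma reproducing x : open_square x -> {for x, continuous g} ->
  g x = tmean (fun u => g u * hyp_kernel n (x.1 - u.1) (x.2 - u.2)).
Proof.
move=> ox gc; rewrite tmean_hyp_kernel; set L := (2 ^ n.+1)%N.
set A := (RHS); apply/eqP; rewrite -subr_eq0 -normr_le0; apply/ler_addgt0Pr => e e0; rewrite add0r.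
have e20 : 0 < e / 2 by rewrite divr_gt0.
have [C HC] := fejer_approx x (e / 2) ox gc e20.
(* The factor 8 L is 4 * 2 L: two weights [cosw] are at most 4 together, and the product of two
   Fejer weights differs from 1 by at most 2 L / N. *)
pose D : R := \sum_(k < L) \sum_(l < L) (8 * L%:R) * `|freq_mean x k l|.
pose m := Num.bound ((`|C| + D) / (e / 2)); pose N := (m + L)%N.
have D0 : 0 <= D.
  by apply: sumr_ge0 => k _; apply: sumr_ge0 => l _; rewrite !mulr_ge0.
have N0 : (0 < N)%N by rewrite addn_gt0 expn_gt0 orbT.
have NR : 0 < N%:R :> R by rewrite ltr0n.
have LN : (L <= N)%N by rewrite leq_addl.
have mN : (`|C| + D) / N%:R <= e / 2.
  rewrite ler_pdivrMr // mulrC -ler_pdivrMr //.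
  have : (`|C| + D) / (e / 2) < m%:R.
    by apply: archi_boundP; rewrite divr_ge0 ?addr_ge0 // ltW.
  by move=> /ltW h; rewrite (le_trans h) // ler_nat leq_addr.
have diff : `|tmean (fun u => g u * (fejer N (x.1 - u.1) * fejer N (x.2 - u.2))) - A|
    <= D / N%:R.
  rewrite tmean_fejer_trunc // -sumrB (le_trans (ler_norm_sum _ _ _)) //.
  rewrite /D mulr_suml; apply: ler_sum => k _.
  rewrite -sumrB (le_trans (ler_norm_sum _ _ _)) // mulr_suml.
  apply: ler_sum => l _; rewrite -mulrBl normrM [leRHS]mulrAC ler_wpM2r //.
  have kN : (k <= N)%N by rewrite (leq_trans _ LN) // ltnW.
  have lN : (l <= N)%N by rewrite (leq_trans _ LN) // ltnW.
  rewrite -[X in _ - X]mulr1 -mulrBr normrM !fejer_coef1B //.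
  have cw j : 0 <= (cosw j : R) <= 2 by rewrite /cosw; case: ifP => _; lra.
  have frac j : (j < L)%N -> 0 <= (j%:R / N%:R : R) <= L%:R / N%:R.
    by move=> jL; rewrite divr_ge0 //= ler_pM2r ?invr_gt0 // ler_nat ltnW.
  have fL : L%:R / N%:R <= 1 :> R by rewrite ler_pdivrMr // mul1r ler_nat.
  have := frac k (ltn_ord k); have := frac l (ltn_ord l).
  move: fL; rewrite -(mulrA 8).
  move: (L%:R / N%:R) (k%:R / N%:R) (l%:R / N%:R) => a b d a1 /andP[d0 da] /andP[b0 ba].
  have -> : 8 * a = 2 * 2 * (2 * a) by ring.
  have /andP[w0 w2] := cw k; have /andP[v0 v2] := cw l.
  apply: ler_pM; rewrite ?normr_ge0 //.
    by rewrite ger0_norm ?mulr_ge0 // ler_pM.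
  rewrite ler_norml; nra.
have -> : g x - A = (g x - tmean (fun u => g u * (fejer N (x.1 - u.1) * fejer N (x.2 - u.2))))
   + (tmean (fun u => g u * (fejer N (x.1 - u.1) * fejer N (x.2 - u.2))) - A) by ring.
rewrite (le_trans (ler_normD _ _)) // (le_trans (lerD (HC _ N0) diff)) //.
have : C / N%:R <= `|C| / N%:R by rewrite ler_pM2r ?invr_gt0 // ler_norm.
by rewrite mulrDl in mN; lra.
Qed.

Lemma hyp_bound x (B : set plane) (M S lam r : R) :
  open_square x -> {for x, continuous g} -> measurable B ->
  0 <= M -> (forall u, torus u -> ~ B u -> `|g u| <= M) ->
  (forall u, torus u -> `|g u| <= S) ->
  0 < lam -> tmean (\1_B) <= r ->
  `|g x| <= M * (36 * n.+1%:R)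
     + S * (lam * r + lam ^- 2 * (cube_const * 4 ^+ n * n.+1%:R)).
Proof.
move=> ox gc mB M0 gM gS lam0 Br.
pose P u := hyp_majorant n (x.1 - u.1) (x.2 - u.2).
have P0 u : 0 <= P u by exact: hyp_majorant_ge0.
have bP : bmeas P by exact: bmeas_hyp_majorant.
have bB : bmeas (\1_B) by exact: bmeas_indic.
have bP3 : bmeas (fun u => P u ^+ 3).
  under eq_fun do rewrite exprS expr2.
  by apply: bmeasM => //; apply: bmeasM.
have bK : bmeas (fun u => hyp_kernel n (x.1 - u.1) (x.2 - u.2)).
  under eq_fun do rewrite (hyp_kernelE _ _ _ _ (leqnn _)).
  apply: bmeas_sum => k; apply: bmeas_sum => l; apply: bmeasM; first exact: bmeas_cst.
  exact: bmeas_cos_cos.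
have Tx : torus x.
  case: ox; rewrite /= !in_itv /= => /andP[a1 a2] /andP[b1 b2].
  by split; rewrite /= in_itv /= ?a2 ?b2 ltW.
have S0 : 0 <= S by apply: le_trans (gS _ Tx).
rewrite (reproducing x) //.
have bgK := bmeasM _ _ bg bK; apply: (le_trans (norm_tmean _ bgK)).
have bc c h : bmeas h -> bmeas (fun u => c * h u).
  by move=> bh; apply: bmeasM => //; exact: bmeas_cst.
(* The cubic term is kept on the whole torus, where its mean is already known; only the term in
   [lam] has to see the size of B. *)
apply: (@le_trans _ _ (tmean (fun u => M * P u + S * (lam * \1_B u + lam ^- 2 * P u ^+ 3)))).
  apply: le_tmean; first exact: bmeas_norm.
    by apply: bmeasD; apply: (bc) => //; apply: bmeasD; exact: (bc).
  move=> u Tu; rewrite normrM.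
  have KP : `|hyp_kernel n (x.1 - u.1) (x.2 - u.2)| <= P u by exact: hyp_kernel_norm.
  apply: (le_trans (ler_wpM2l (normr_ge0 _) KP)).
  have l2 : 0 <= lam ^- 2 * P u ^+ 3.
    by rewrite mulr_ge0 ?invr_ge0 ?exprn_ge0 // ltW.
  rewrite indicE; have [uB|uB] := boolP (u \in B); last first.
    rewrite mulr0 add0r (le_trans (y := M * P u)) //.
      by rewrite ler_wpM2r // gM //; move=> /mem_set; exact/negP.
    by rewrite lerDl mulr_ge0.
  apply: (le_trans (ler_wpM2r (P0 u) (gS _ Tu))).
  apply: (@le_trans _ _ (S * (lam * 1 + lam ^- 2 * P u ^+ 3))); last first.
    by rewrite lerDr mulr_ge0.
  rewrite ler_wpM2l // mulr1.
  have [Pl|lP] := leP (P u) lam; first by rewrite (le_trans Pl) // lerDl.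
  rewrite (le_trans (y := lam ^- 2 * P u ^+ 3)) //; last by rewrite lerDr ltW.
  rewrite mulrC ler_pdivlMr ?exprn_gt0 // [P u ^+ 3]exprS ler_wpM2l //.
  by rewrite ler_pXn2r ?nnegrE // ltW.
rewrite tmeanD; [|exact: (bc)|by apply: (bc _ (fun u => _)); apply: bmeasD; exact: (bc)].
rewrite tmeanZ // tmeanZ; last by apply: bmeasD; exact: (bc).
rewrite tmeanD; [|exact: (bc)..]; rewrite !tmeanZ //.
apply: lerD; first by rewrite ler_wpM2l // tmean_hyp_majorant.
rewrite ler_wpM2l // lerD // ler_wpM2l //; first exact: ltW.
  by rewrite invr_ge0 exprn_ge0 // ltW.
exact: tmean_hyp_majorant_cube.
Qed.

End FixedFunction.
End Reproducing.

(** * The Remez inequality *)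

Section Remez.
Context {R : realType}.
Local Notation plane := (measurableTypeR R * measurableTypeR R)%type.
Implicit Types (x u : R * R) (n k l : nat).

(** The measure of B is an outer measure, so a countable cover by measurable sets replaces B;
    allowing an excess equal to the bound itself costs the factor 2. Enlarging B is harmless: bounds
    known off B remain valid off B'. *)
Lemma measurable_hull (B : set (R * R)) (r : R) : 0 < r ->
  (nmeas B <= r%:E)%E ->
  exists2 B' : set plane, measurable B' & B `<=` B' /\ tmean (\1_B') <= 2 * r.
Proof.
move=> r0; rewrite /nmeas => Br.
have P0 : 0 < (2 * pi) ^+ 2 :> R by rewrite exprn_gt0 // twopi_gt0.
have {}Br : (mu_ext (leb2 R) B <= ((2 * pi) ^+ 2 * r)%:E)%E.
  have := lee_wpmul2l (_ : (0 <= ((2 * pi) ^+ 2)%:E)%E) Br.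
  rewrite lee_fin muleA -!EFinM => /(_ (ltW P0)).
  by rewrite mulfV ?gt_eqF // mul1e.
have e0 : 0 < (2 * pi) ^+ 2 * r by rewrite mulr_gt0.
have fin : mu_ext (leb2 R) B \is a fin_num.
  by rewrite ge0_fin_numE ?mu_ext_ge0 // (le_lt_trans Br) // ltry.
have [_ [A [mA BA] <-] Alt] := lb_ereal_inf_adherent e0 fin.
have mU : measurable (\bigcup_k A k : set plane) by exact: bigcup_measurable.
exists (\bigcup_k A k) => //; split => //.
apply: tmean_indic_le => //.
apply: (@le_trans _ _ (\sum_(k <oo) leb2 R (A k))%E).
  have /(_ (@subset_refl _ _)) := @measure_sigma_subadditive _ R _ (leb2 R) _ A mA mU; exact.
apply: (le_trans (ltW Alt)).
have -> : (2 * pi) ^+ 2 * (2 * r) = (2 * pi) ^+ 2 * r + (2 * pi) ^+ 2 * r :> R by ring.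
by rewrite EFinD leeD2r.
Qed.

Lemma continuous_bmeas (g : R * R -> R) : continuous g ->
  measurable_fun (@torus R : set plane) (g : plane -> R) -> bmeas g.
Proof.
move=> gc mg; split => //.
have cK : compact (`[0, 2 * pi]%classic `*` `[0, 2 * pi]%classic : set (R * R)).
  by apply: compact_setX; exact: segment_compact.
have /compact_bounded[M [_ HM]] := continuous_compact (continuous_subspaceT gc) cK.
exists (M + 1) => u [u1 u2]; apply: (HM (M + 1)); first by rewrite ltrDl.
exists u => //; rewrite /= !in_itv /= in u1 u2.
case/andP: u1 => a1 b1; case/andP: u2 => a2 b2.
by split; rewrite /= in_itv /= ?a1 ?a2 ltW.
Qed.

Lemma open_square_dense (g : R * R -> R) (D : R) : continuous g ->
  (forall x, open_square x -> `|g x| <= D) -> forall x, torus x -> `|g x| <= D.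
Proof.
move=> gc gD [x1 x2] [/= X1 X2]; rewrite /= !in_itv /= in X1 X2.
case/andP: X1 => a1 b1; case/andP: X2 => a2 b2.
apply/ler_addgt0Pr => e e0.
have /cvgrPdist_lt /(_ e e0) := gc (x1, x2).
move=> /nbhs_ballP[d /= d0 H].
(* The half-open square contains its lower edges only, so increasing both coordinates slightly
   always leads into the open square. *)
pose h := Num.min (d / 2) (Num.min ((2 * pi - x1) / 2) ((2 * pi - x2) / 2)).
have h0 : 0 < h by rewrite /h !lt_min; lra.
have [hd h1 h2] : [/\ h <= d / 2, h <= (2 * pi - x1) / 2 & h <= (2 * pi - x2) / 2].
  by rewrite /h !ge_min !lexx ?orbT.
have /gD gy : open_square (x1 + h, x2 + h) by split; rewrite /= in_itv /=; lra.
have /H : ball (x1, x2) d (x1 + h, x2 + h).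
  by split; rewrite /ball /= opprD addrA subrr sub0r normrN gtr0_norm //; lra.
rewrite /= => gxy.
have -> : g (x1, x2) = (g (x1, x2) - g (x1 + h, x2 + h)) + g (x1 + h, x2 + h) by ring.
by rewrite (le_trans (ler_normD _ _)) // addrC lerD // ltW.
Qed.

Definition remez_const : R := 8 * cube_const.

Lemma remez_real n (g : R * R -> R) (B : set plane) (M : R) :
  (1 <= n)%N -> continuous g -> bmeas g ->
  (forall k l x, ~ Q n (Posz k, Posz l) ->
     tmean (fun u => g u * (shift_cos x.1 k u.1 * shift_cos x.2 l u.2)) = 0) ->
  measurable B ->
  tmean (\1_B) <= 2 * (8 * remez_const * 2 ^+ n * Num.sqrt n%:R)^-1 ->
  0 <= M -> (forall u, torus u -> ~ B u -> `|g u| <= M) ->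
  forall x, torus x -> `|g x| <= 144 * n%:R * M.
Proof.
move=> n1 gc bg gQ mB Br M0 gM.
pose T : set R := [set `|g u| | u in @torus R].
have T0 : T !=set0.
  by exists `|g (0, 0)|; exists (0, 0) => //; split;
    rewrite /= in_itv /= lexx twopi_gt0.
have Tub : has_ubound T.
  by have [_ [c gc']] := bg; exists c => _ [u Tu <-]; exact: gc'.
have gS u : torus u -> `|g u| <= sup T.
  by move=> Tu; apply: ub_le_sup => //; exists u.
have nR : 1 <= n%:R :> R by rewrite ler1n.
have sq0 : 0 < Num.sqrt n%:R :> R by rewrite sqrtr_gt0; lra.
have p0 : 0 < 2 ^+ n :> R by rewrite exprn_gt0.
have c1 : 1 <= cube_const :> R by rewrite /cube_const; lra.
have k1 : 8 <= remez_const by rewrite /remez_const; lra.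
(* With this choice lam |B| <= lam * 2 / (8 lam) = 1/4, and lam^2 absorbs the growth 4^n (n + 1) of
   the third moment, leaving at most 1/4 again. *)
pose lam : R := remez_const * 2 ^+ n * Num.sqrt n%:R.
have lam0 : 0 < lam by rewrite !mulr_gt0 //; lra.
have S0 : 0 <= sup T by have [_ [u Tu _]] := T0; apply: le_trans (gS _ Tu).
have lam2 : lam ^+ 2 = remez_const ^+ 2 * 4 ^+ n * n%:R.
  rewrite /lam !exprMn sqr_sqrtr; last lra.
  by rewrite -exprM mulnC exprM; congr (_ * _ ^+ n * _); ring.
have n2 : n.+1%:R <= 2 * n%:R :> R by rewrite -natr1; lra.
have bnd x : open_square x -> `|g x| <= 72 * n%:R * M + sup T / 2.
  move=> ox.
  apply: (le_trans (hyp_bound n g bg gQ x B M (sup T) lam _ ox (gc x) mB M0 gM gS lam0 Br)).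
  apply: lerD.
    have : M * n.+1%:R <= M * (2 * n%:R) by rewrite ler_wpM2l.
    lra.
  rewrite ler_wpM2l //.
  have -> : lam * (2 * (8 * remez_const * 2 ^+ n * Num.sqrt n%:R)^-1) = 1 / 4.
    have -> : 8 * remez_const * 2 ^+ n * Num.sqrt n%:R = 8 * lam by rewrite /lam; ring.
    by field; rewrite gt_eqF.
  have : lam ^- 2 * (cube_const * 4 ^+ n * n.+1%:R) <= 1 / 4.
    have p4 : 0 < 4 ^+ n :> R by rewrite exprn_gt0.
    rewrite mulrC ler_pdivrMr ?exprn_gt0 // lam2.
    have -> : 1 / 4 * (remez_const ^+ 2 * 4 ^+ n * n%:R) =
        cube_const * 4 ^+ n * (16 * cube_const * n%:R) by rewrite /remez_const; field.
    have c0 : 0 <= cube_const * 4 ^+ n :> R by rewrite mulr_ge0 ?(ltW p4) //; lra.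
    rewrite ler_wpM2l //.
    by rewrite (le_trans n2) // ler_wpM2r; lra.
  lra.
(* The supremum is finite, so its half can be absorbed: 72 becomes 144. The 72 itself is 36 * 2,
   from n + 1 <= 2 n. *)
have supT : sup T <= 72 * n%:R * M + sup T / 2.
  by apply: ge_sup => // _ [u Tu <-]; exact: (open_square_dense g _ gc bnd).
by move=> x Tx; have := gS _ Tx; lra.
Qed.

(** * From the complex spectrum to real cosine means *)

Lemma normc_bounds (z : R[i]) :
  [/\ `|complex.Re z| <= Normc.normc z, `|complex.Im z| <= Normc.normc z &
      Normc.normc z <= `|complex.Re z| + `|complex.Im z|].
Proof.
case: z => a b /=; split.
- by rewrite -sqrtr_sqr ler_wsqrtr // lerDl sqr_ge0.
- by rewrite -sqrtr_sqr ler_wsqrtr // lerDr sqr_ge0.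
- have s0 : 0 <= `|a| + `|b| by rewrite addr_ge0.
  rewrite -(ger0_norm s0) -sqrtr_sqr ler_wsqrtr // sqrrD !real_normK ?num_real //.
  by rewrite lerD2r lerDl mulrn_wge0 // mulr_ge0.
Qed.

Lemma normc_norm (z : R[i]) : `|z| = (Normc.normc z)%:C%C.
Proof. by rewrite normc_def; case: z. Qed.

Lemma continuous_Re_Im (f : R * R -> R[i]) : continuous (f : R * R -> R[i]^o) ->
  continuous (fun u => complex.Re (f u)) /\ continuous (fun u => complex.Im (f u)).
Proof.
move=> fc; split=> x; apply/cvgrPdist_lt => e e0;
  have /cvgrPdist_lt /(_ e%:C%C) := fc x; rewrite ltcR => /(_ e0);
  apply: filterS => y; rewrite /= normc_norm ltcR; apply: le_lt_trans;
  have [re im _] := normc_bounds (f x - f y).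
- by move: re; rewrite raddfB.
- by move: im; rewrite raddfB.
Qed.

Definition wave (k : int * int) (u : R * R) : R := k.1%:~R * u.1 + k.2%:~R * u.2.

Lemma bmeas_wave (c : R -> R) (k : int * int) : continuous c ->
  (forall t, `|c t| <= 1) -> bmeas (fun u => c (wave k u)).
Proof.
move=> cc c1; split; last by exists 1.
apply: measurable_funTS; apply: (measurableT_comp (continuous_measurable_fun cc)).
by apply: measurable_funD; apply: measurable_funM;
  (exact: measurable_cst || exact: measurable_fst || exact: measurable_snd).
Qed.

Lemma fourier_coef0 (f : R * R -> R[i]) (k : int * int) :
  bmeas (fun u => complex.Re (f u)) -> bmeas (fun u => complex.Im (f u)) ->
  fourier_coef f k = 0 ->
  tmean (fun u => complex.Re (f u) * cos (wave k u))
    + tmean (fun u => complex.Im (f u) * sin (wave k u)) = 0 /\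
  tmean (fun u => complex.Im (f u) * cos (wave k u))
    - tmean (fun u => complex.Re (f u) * sin (wave k u)) = 0.
Proof.
move=> br bi; rewrite /fourier_coef /torus_int.
move=> h.
pose a u := complex.Re (f u); pose b u := complex.Im (f u).
have bc := bmeas_wave cos k (@continuous_cos R) (@cos_max R).
have bs := bmeas_wave sin k (@continuous_sin R) (@sin_max R).
have [hre him] : tmean (fun u => a u * cos (wave k u) + b u * sin (wave k u)) = 0 /\
    tmean (fun u => b u * cos (wave k u) + -1 * (a u * sin (wave k u))) = 0.
  rewrite (_ : (fun u => a u * _ + _) = (fun u => complex.Re (f u * expNi k u))); last first.
    by apply/funext => u; rewrite /a /b /expNi /wave; case: (f u) => p q /=; ring.
  rewrite (_ : (fun u => b u * _ + _) = (fun u => complex.Im (f u * expNi k u))); last first.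
    by apply/funext => u; rewrite /a /b /expNi /wave; case: (f u) => p q /=; ring.
  by move: h => /= -[]; rewrite !mul0r subr0 addr0 /tmean.
rewrite tmeanD in hre; [|exact: bmeasM..].
rewrite tmeanD in him; [|exact: bmeasM|].
  by rewrite tmeanZ ?mulN1r in him; [split|exact: bmeasM].
by apply: bmeasM; [exact: bmeas_cst|exact: bmeasM].
Qed.

Lemma Q_absz n (k k' : int * int) : `|k.1|%N = `|k'.1|%N -> `|k.2|%N = `|k'.2|%N ->
  Q n k -> Q n k'.
Proof.
move=> e1 e2 [s sn [h1 h2]]; exists s => //.
by split; rewrite /dyadic_range -?e1 -?e2.
Qed.

(** One coefficient gives two real relations between four means. The coefficient at -k, also off
    Q_n, gives the same two with the sines negated, and the four relations separate the means. *)
Lemma wave_vanish n (f : R * R -> R[i]) (k : int * int) :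
  bmeas (fun u => complex.Re (f u)) -> bmeas (fun u => complex.Im (f u)) ->
  (forall k : int * int, ~ Q n k -> fourier_coef f k = 0) -> ~ Q n k ->
  [/\ tmean (fun u => complex.Re (f u) * cos (wave k u)) = 0,
      tmean (fun u => complex.Re (f u) * sin (wave k u)) = 0,
      tmean (fun u => complex.Im (f u) * cos (wave k u)) = 0 &
      tmean (fun u => complex.Im (f u) * sin (wave k u)) = 0].
Proof.
move=> br bi fQ nQ; pose k' := (- k.1, - k.2).
have nQ' : ~ Q n k' by move=> /Q_absz h; apply: nQ; apply: h; rewrite /= abszN.
have [e1 e2] := fourier_coef0 f k br bi (fQ _ nQ).
have [e3 e4] := fourier_coef0 f k' br bi (fQ _ nQ').
have wN u : wave k' u = - wave k u by rewrite /wave /= !mulrNz; ring.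
have neg h : bmeas h -> tmean (fun u => h u * sin (wave k' u)) =
    - tmean (fun u => h u * sin (wave k u)).
  move=> bh; rewrite -mulN1r -tmeanZ.
    by congr tmean; apply/funext => u; rewrite wN sinN; ring.
  by apply: bmeasM => //; apply: bmeas_wave; [exact: continuous_sin|exact: sin_max].
rewrite !neg // in e3 e4.
have ce h : tmean (fun u => h u * cos (wave k' u)) = tmean (fun u => h u * cos (wave k u)).
  by congr tmean; apply/funext => u; rewrite wN cosN.
rewrite !ce in e3 e4.
by split; lra.
Qed.

(** The product of cosines is half the sum of two cosines of shifted phases, with frequencies (k, l)
    and (k, -l), which are both off Q_n. *)
Lemma wave_vanish_shift n (h : R * R -> R) k l x : bmeas h ->
  (forall k : int * int, ~ Q n k -> tmean (fun u => h u * cos (wave k u)) = 0 /\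
                        tmean (fun u => h u * sin (wave k u)) = 0) ->
  ~ Q n (Posz k, Posz l) ->
  tmean (fun u => h u * (shift_cos x.1 k u.1 * shift_cos x.2 l u.2)) = 0.
Proof.
move=> bh hQ nQ; pose kp := (Posz k, Posz l); pose km := (Posz k, - Posz l).
have nQ' : ~ Q n km by move=> /Q_absz H; apply: nQ; apply: H; rewrite /= ?abszN.
have [p1 p2] := hQ kp nQ; have [m1 m2] := hQ km nQ'.
have bc j : bmeas (fun u => h u * cos (wave j u)).
  by apply: bmeasM => //; apply: bmeas_wave; [exact: continuous_cos|exact: cos_max].
have bs j : bmeas (fun u => h u * sin (wave j u)).
  by apply: bmeasM => //; apply: bmeas_wave; [exact: continuous_sin|exact: sin_max].
have -> : (fun u => h u * (shift_cos x.1 k u.1 * shift_cos x.2 l u.2)) = (fun u =>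
    (cos (wave kp x) / 2) * (h u * cos (wave kp u)) +
    (sin (wave kp x) / 2) * (h u * sin (wave kp u)) +
    ((cos (wave km x) / 2) * (h u * cos (wave km u)) +
    (sin (wave km x) / 2) * (h u * sin (wave km u)))).
  apply/funext => u; rewrite /shift_cos.
  transitivity (h u * ((cos (wave kp x - wave kp u) + cos (wave km x - wave km u)) / 2)).
    congr (_ * _).
    have -> : wave kp x - wave kp u = k%:R * (x.1 - u.1) + l%:R * (x.2 - u.2).
      by rewrite /wave /= -!pmulrn; ring.
    have -> : wave km x - wave km u = k%:R * (x.1 - u.1) - l%:R * (x.2 - u.2).
      by rewrite /wave /= mulrNz -!pmulrn; ring.
    by rewrite cosD cosB; field.
  by rewrite !cosB; field.
have bZ c j : bmeas j -> bmeas (fun u => c * j u).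
  by move=> bj; apply: bmeasM => //; exact: bmeas_cst.
rewrite !tmeanD ?tmeanZ ?p1 ?p2 ?m1 ?m2 //; try (exact: (bZ)).
- by rewrite !mulr0 !addr0.
- by apply: bmeasD; exact: (bZ).
- by apply: bmeasD; exact: (bZ).
Qed.

End Remez.

(* An element of T(DeltaQ n), which is a trigonometric polynomial, is given by
   its continuous representative, so that pointwise suprema make sense. *)
Theorem theorem3p4 (R : realType) :
  exists C1 C2 : R, 0 < C1 /\ 0 < C2 /\
    forall (n : nat), (1 <= n)%N ->
    forall B : set (R * R), B `<=` @torus R -> leb2_measurable B ->
      (nmeas B <= ((C2 * 2 ^+ n * Num.sqrt n%:R)^-1)%:E)%E ->
    forall f : R * R -> R[i],
      T_space (DeltaQ n) f -> continuous (f : R * R -> R[i]^o) ->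
      (sup_norm_on (@torus R) f
         <= (C1 * n%:R)%:E * sup_norm_on (@torus R `\` B) f)%E.
Proof.
have cc1 : 1 <= cube_const :> R by rewrite /cube_const; lra.
have rc8 : 8 <= remez_const :> R by rewrite /remez_const; lra.
(* 288 is 144 for the real part plus 144 for the imaginary part. *)
exists 288, (8 * remez_const); split; first by rewrite ltr0n.
split; first lra.
move=> n n1 B _ _ Br f [[_ ire iim] fQ] fc.
have [rec imc] := continuous_Re_Im f fc.
have br : bmeas (fun u => complex.Re (f u)).
  by apply: continuous_bmeas => //; apply/measurable_EFinP; exact: measurable_int ire.
have bi : bmeas (fun u => complex.Im (f u)).
  by apply: continuous_bmeas => //; apply/measurable_EFinP; exact: measurable_int iim.
have vanish k (nk : ~ Q n k) : fourier_coef f k = 0 by apply: fQ => -[].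
have nR : 1 <= n%:R :> R by rewrite ler1n.
have sq1 : 1 <= Num.sqrt n%:R :> R by rewrite -[X in X <= _]sqrtr1 ler_wsqrtr.
have p1 : 1 <= 2 ^+ n :> R by rewrite exprn_ege1 // ler1n.
have X64 : 64 <= 8 * remez_const * 2 ^+ n * Num.sqrt n%:R :> R.
  have mul64 (a b : R) : 64 <= a -> 1 <= b -> 64 <= a * b by move=> *; nra.
  by apply: (mul64) => //; apply: (mul64) => //; lra.
have X0 : 0 < 8 * remez_const * 2 ^+ n * Num.sqrt n%:R :> R by lra.
have r0 : 0 < (8 * remez_const * 2 ^+ n * Num.sqrt n%:R)^-1 :> R by rewrite invr_gt0.
have [B' mB' [BB' B'r]] := measurable_hull B _ r0 Br.
(* The supremum over an empty set would be -oo. The hull has mean at most 2/64 < 1, so B cannot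
   cover the torus. *)
have [u0 [Tu0 Bu0]] : exists u, torus u /\ ~ B u.
  apply: contrapT => /forallNP H.
  have : 1 <= tmean (\1_B') :> R.
    rewrite -(tmean_cst 1); apply: le_tmean; first exact: bmeas_cst.
      exact: bmeas_indic.
    move=> u Tu; rewrite indicE mem_set //; apply: BB'.
    by apply: contrapT => nB; apply: (H u).
  move=> h; have := le_trans h B'r.
  have : (8 * remez_const * 2 ^+ n * Num.sqrt n%:R)^-1 <= 64^-1 :> R.
    by rewrite lef_pV2 ?posrE.
  lra.
set M := sup_norm_on (_ `\` _) f.
have Mu u : torus u -> ~ B u -> ((Normc.normc (f u))%:E <= M)%E.
  by move=> Tu nBu; apply: ereal_sup_ubound; exists u.
have M0 : (0 <= M)%E.
  apply: le_trans (Mu _ Tu0 Bu0); rewrite lee_fin.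
  by have [h _ _] := normc_bounds (f u0); apply: le_trans h.
have [My|] := eqVneq M +oo%E.
  rewrite My gt0_muley; first exact: leey.
  by rewrite lte_fin; apply: mulr_gt0; rewrite ltr0n.
move=> Mny; have Mfin : M \is a fin_num by rewrite ge0_fin_numE // ltey.
move: (fineK Mfin) Mu M0 => <-; move: (fine M) => m Mu; rewrite lee_fin => m0.
apply: ge_ereal_sup => _ [u Tu <-]; rewrite -EFinM lee_fin.
have fm v : torus v -> ~ B' v -> Normc.normc (f v) <= m.
  by move=> Tv nBv; rewrite -lee_fin; apply: Mu => // /BB'.
have [_ _ fu] := normc_bounds (f u); apply: (le_trans fu).
have R1 : `|complex.Re (f u)| <= 144 * n%:R * m.
  apply: (remez_real n (fun u => complex.Re (f u)) B') => //.
    by move=> k l x nQ; apply: (wave_vanish_shift n) => // j nj;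
      have [? ? _ _] := wave_vanish n f j br bi vanish nj.
  by move=> v Tv nBv; have [h _ _] := normc_bounds (f v); apply: le_trans h (fm _ Tv nBv).
have I1 : `|complex.Im (f u)| <= 144 * n%:R * m.
  apply: (remez_real n (fun u => complex.Im (f u)) B') => //.
    by move=> k l x nQ; apply: (wave_vanish_shift n) => // j nj;
      have [_ _ ? ?] := wave_vanish n f j br bi vanish nj.
  by move=> v Tv nBv; have [_ h _] := normc_bounds (f v); apply: le_trans h (fm _ Tv nBv).
by apply: (le_trans (lerD R1 I1)); lra.
Qed.
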